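(* Let $\Gamma$ be a matroid complex on the vertex set $[n]=\{1,\dots,n\}$ and suppose $\dim(\Gamma)=d-1$. Let $k$ be a field and $S=k[x_1,\dots,x_n]$. Then there exists a deformation of the Stanley-Reisner ideal $I_\Gamma\subset S$ that is a generic monomial ideal and is Cohen-Macaulay.
   Context: A simplicial complex $\Gamma$ on $[n]$ is a non-empty collection of subsets of $[n]$ (faces), closed under taking subsets, with $\{i\}\in\Gamma$ for all $i\in[n]$; $\dim(\sigma)=|\sigma|-1$ and $\dim(\Gamma)$ is the maximum dimension of a face. A minimal non-face is a set $\sigma\subseteq[n]$ with $\sigma\notin\Gamma$ and $\sigma\setminus\{i\}\in\Gamma$ for each $i\in\sigma$. $\Gamma$ is a matroid complex if for any two distinct minimal non-faces $\alpha,\beta$ and any $i\in\alpha\cap\beta$ there is a minimal non-face $\gamma\subseteq(\alpha\cup\beta)\setminus\{i\}$. The Stanley-Reisner ideal is $I_\Gamma=\langle \prod_{i\in\sigma}x_i : \sigma\subseteq[n],\ \sigma\notin\Gamma\rangle$; its minimal generators correspond to the minimal non-faces. A deformation of a square-free monomial ideal $I$ with minimal generators $m_1,\dots,m_t$ is a monomial ideal $M=\langle m_1^*,\dots,m_t^*\rangle$ such that for each $i$, if $m_i=x_{i_1}\cdots x_{i_s}$, then $m_i^*=x_{i_1}^{j_1}\cdots x_{i_s}^{j_s}$ for some positive integers $j_1,\dots,j_s$. $x^{a}$ strictly divides $x^{b}$ if $a_i<b_i$ for every $i$ with $a_i>0$. A monomial ideal is generic if for any two distinct minimal generators $m_i,m_j$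 having the same positive degree in some variable, there is a third minimal generator that strictly divides $\mathrm{lcm}(m_i,m_j)$. An ideal $M$ is Cohen-Macaulay if $S/M$ is a Cohen-Macaulay ring. *)

(* Defs.v *)
From HB Require Import structures.
From mathcomp Require Import all_boot all_order all_algebra.
From mathcomp Require Import ring_quotient.
From mathcomp Require Import mpoly.

Set Implicit Arguments.
Unset Strict Implicit.
Unset Printing Implicit Defensive.

Import Order.TTheory GRing.Theory Num.Theory.
Local Open Scope ring_scope.

Section CohenMacaulay.

Variable R : comNzRingType.

(* Ideals given by generators need not be decidable or proper, so they are
   [Prop]-valued. The [idealr] structure of the library is used for proper
   ideals; under classical logic its Boolean membership is no restriction. *)
Definition gen_ideal (G : R -> Prop) (x : R) : Prop :=
  exists l : seq (R * R),
    (forall c, c \in l -> G c.2) /\ x = \sum_(c <- l) c.1 * c.2.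

Definition seq_ideal (s : seq R) : R -> Prop := gen_ideal (fun x => x \in s).

(* The unit ideal is not an [idealr], but it is always finitely generated. *)
Definition noetherian : Prop :=
  forall I : idealr R, exists s : seq R, forall x, x \in I <-> seq_ideal s x.

Definition maximal_ideal (P : idealr R) : Prop :=
  forall J : idealr R, {subset P <= J} -> {subset J <= P}.

(* P = C 0 > C 1 > ... > C r; the values C i with i > r are irrelevant. *)
Definition prime_chain (P : idealr R) (r : nat) : Prop :=
  exists C : nat -> prime_idealr R,
    C 0%N =i P /\
    forall i, (i < r)%N ->
      {subset C i.+1 <= C i} /\ ~ {subset C i <= C i.+1}.

Definition has_height (P : idealr R) (h : nat) : Prop :=
  prime_chain P h /\ forall r, prime_chain P r -> (r <= h)%N.

Definition regular_seq (s : seq R) : Prop :=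
  ~ seq_ideal s 1 /\
  forall i, (i < size s)%N ->
    forall y, seq_ideal (take i s) (s`_i * y) -> seq_ideal (take i s) y.

Definition has_depth (P : idealr R) (t : nat) : Prop :=
  (exists s, [/\ regular_seq s, {subset s <= P} & size s = t]) /\
  forall s, regular_seq s -> {subset s <= P} -> (size s <= t)%N.

(* Eisenbud, "Commutative Algebra", Section 18.2: a Noetherian ring is
   Cohen-Macaulay when depth P = codim P for every maximal ideal P. *)
Definition cohen_macaulay : Prop :=
  noetherian /\
  forall P : idealr R, maximal_ideal P ->
    exists h, has_height P h /\ has_depth P h.

End CohenMacaulay.

Section Complexes.

Variable n : nat.
Implicit Types (G : {set {set 'I_n}}) (s t : {set 'I_n}).

Definition simplicial_complex G : Prop :=
  [/\ G != set0,
      forall s t, s \in G -> t \subset s -> t \in G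
    & forall i : 'I_n, [set i] \in G].

Definition face_dim s : int := #|s|%:Z - 1.

(* Every face has dimension at least -1, the default value of the maximum. *)
Definition complex_dim G : int := \big[Num.max/-1]_(s in G) face_dim s.

Definition minimal_nonface G s : Prop :=
  s \notin G /\ forall i, i \in s -> s :\ i \in G.

Definition matroid_complex G : Prop :=
  simplicial_complex G /\
  forall s t, minimal_nonface G s -> minimal_nonface G t -> s <> t ->
    forall i, i \in s :&: t ->
      exists u, minimal_nonface G u /\ u \subset (s :|: t) :\ i.

End Complexes.

Section MonomialIdeals.

Variables (k : fieldType) (n : nat).
Implicit Types (I M : {mpoly k[n]} -> Prop) (a b c : 'X_{1..n}).

Definition stanley_reisner (G : {set {set 'I_n}}) : {mpoly k[n]} -> Prop :=
  gen_ideal (fun q => exists2 s : {set 'I_n}, s \notin G & q = \prod_(i in s) 'X_i).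

Definition mono_ideal (A : 'X_{1..n} -> Prop) : {mpoly k[n]} -> Prop :=
  gen_ideal (fun q => exists2 a, A a & q = 'X_[a]).

Definition monomial_ideal I : Prop :=
  exists A : 'X_{1..n} -> Prop, forall p, I p <-> mono_ideal A p.

(* The minimal generators of a monomial ideal are the monomials in it that are
   minimal for divisibility; (b <= a)%MM says that 'X_[b] divides 'X_[a]. *)
Definition min_gen I a : Prop :=
  I 'X_[a] /\ forall b, I 'X_[b] -> (b <= a)%MM -> b = a.

(* f sends the exponent of m_i to that of m_i^*; its values off the minimal
   generators of I are irrelevant. *)
Definition deformation I M : Prop :=
  exists f : 'X_{1..n} -> 'X_{1..n},
    (forall a, min_gen I a -> forall i, (0 < f a i)%N = (0 < a i)%N) /\
    forall p, M p <-> mono_ideal (fun b => exists2 a, min_gen I a & b = f a) p.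

Definition strictly_divides a b : Prop :=
  forall i, (0 < a i)%N -> (a i < b i)%N.

Definition generic_ideal M : Prop :=
  monomial_ideal M /\
  forall a b, min_gen M a -> min_gen M b -> a <> b ->
    (exists i, (0 < a i)%N /\ a i = b i) ->
    exists c, [/\ min_gen M c, c <> a, c <> b & strictly_divides c (mlcm a b)].

End MonomialIdeals.

Arguments stanley_reisner k {n} G _.

(* Main.v *)
Require Import Defs.
From HB Require Import structures.
From mathcomp Require Import all_boot all_order all_algebra.
From mathcomp Require Import ring_quotient.
From mathcomp Require Import mpoly.
From mathcomp Require Import boolp.
From mathcomp Require classical_sets.
From mathcomp Require Import zify ring.

Set Implicit Arguments.
Unset Strict Implicit.
Unset Printing Implicit Defensive.

Import Order.TTheory GRing.Theory Num.Theory.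
Local Open Scope ring_scope.

(**
  The deformation is [M], generated by the monomials [x_C ^ (top C)], the product
  of the variables of a circuit [C] each raised to the power [top C], where
  [top C - 1] is the largest index in [C] (indices start at 0). If two
  generators share a positive exponent in a common variable, their circuits have
  the same largest element; eliminating it gives a circuit with a smaller
  exponent, hence a generator strictly dividing the lcm.

  [S/M] is filtered, via the sequences [0 -> S/(I:m) -> S/I -> S/(I+m) -> 0],
  by complete intersections [S/(x_i ^ (a i), i notin B)], [B] a basis of the
  matroid. Treat the circuits by increasing [top]: when those with top at most [t]
  have been dealt with, the ideal has the form [stage t B s a], where
  the elements of [B] below [t] form a basis of the initial segment, so that [B]
  contains at most one circuit of top [t + 1]; its monomial is then split into
  its pure powers, and each choice removes one element of that circuit from [B].

  A maximal ideal contains a monic polynomial [p_i(x_i)] in each variable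
  (Zariski's lemma). After multiplying by [x_i ^ n], the elementary symmetric
  polynomials of degrees [d, ..., 1] in the [p_i(x_i)] form a regular sequence
  on each of these complete intersections, hence on [S/M]. Conversely, a regular
  sequence in a prime gives a chain of primes of the same length, and no chain of
  primes of [S/M] is longer than [d], because modulo a prime the variables that
  survive form a face: [d + 1] polynomials in [d] variables are algebraically
  dependent, whereas elements separating the primes of a chain are independent.
*)

(** * Prime ideals and regular sequences *)

Section Ideals.

Variable R : comNzRingType.
Implicit Types (I J : R -> Prop) (x y f : R).

Definition is_ideal I : Prop :=
  I 0 /\ forall a x y, I x -> I y -> I (a * x + y).

Definition add_gen I f : R -> Prop := fun x => exists a, I (x - a * f).

Definition colon I f : R -> Prop := fun x => I (f * x).

Lemma is_idealD I x y : is_ideal I -> I x -> I y -> I (x + y).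
Proof. by move=> [_ hI] Ix Iy; rewrite -[x]mul1r; apply: hI. Qed.

Lemma is_idealM I a x : is_ideal I -> I x -> I (a * x).
Proof. by move=> [I0 hI] Ix; rewrite -[a * x]addr0; apply: hI. Qed.

Lemma is_idealN I x : is_ideal I -> I x -> I (- x).
Proof. by move=> hI Ix; rewrite -mulN1r; apply: is_idealM. Qed.

Lemma is_idealB I x y : is_ideal I -> I x -> I y -> I (x - y).
Proof. by move=> hI Ix Iy; apply: is_idealD => //; apply: is_idealN. Qed.

Lemma is_ideal_sum I (T : Type) (r : seq T) (P : pred T) (F : T -> R) :
  is_ideal I -> (forall i, P i -> I (F i)) -> I (\sum_(i <- r | P i) F i).
Proof.
move=> hI hF; apply: (big_ind I) => //; first by case: hI.
by move=> x y; apply: is_idealD.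
Qed.

Lemma is_ideal_add_gen I f : is_ideal I -> is_ideal (add_gen I f).
Proof.
move=> hI; split=> [|a x y [b Ix] [c Iy]].
  by exists 0; rewrite mul0r subr0; case: hI.
exists (a * b + c); have -> : a * x + y - (a * b + c) * f =
  a * (x - b * f) + (y - c * f) by ring.
by case: hI => _; apply.
Qed.

Lemma add_genW I f x : is_ideal I -> I x -> add_gen I f x.
Proof. by exists 0; rewrite mul0r subr0. Qed.

Lemma add_gen_gen I f : is_ideal I -> add_gen I f f.
Proof. by exists 1; rewrite mul1r subrr; case: H. Qed.

Lemma is_ideal_idealr (J : idealr R) : is_ideal (fun x => x \in J).
Proof.
split=> [|a x y Jx Jy]; first exact: idealr0.
by rewrite rpredD // idealMr.
Qed.

Lemma gen_ideal_is_ideal (G : R -> Prop) : is_ideal (gen_ideal G).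
Proof.
split=> [|a x y [l [lG ->]] [l' [lG' ->]]].
  by exists [::]; split=> //; rewrite big_nil.
exists ([seq (a * c.1, c.2) | c <- l] ++ l'); split=> [c|].
  by rewrite mem_cat => /orP[/mapP[c' /lG Gc' ->]|/lG'].
rewrite big_cat big_map /= big_distrr /=.
by congr (_ + _); apply: eq_bigr => c _; rewrite mulrA.
Qed.

Lemma gen_idealW (G : R -> Prop) x : G x -> gen_ideal G x.
Proof.
by exists [:: (1, x)]; split=> [c|]; rewrite ?inE ?big_seq1 ?mul1r // => /eqP->.
Qed.

Lemma gen_ideal_min (G : R -> Prop) I x :
  is_ideal I -> (forall y, G y -> I y) -> gen_ideal G x -> I x.
Proof.
move=> hI GI [l [lG ->]]; rewrite big_seq; apply: is_ideal_sum => // c cl.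
by apply: is_idealM => //; apply/GI/lG.
Qed.

(** Excluded middle makes the predicate Boolean, as [idealr] demands; properness is built into that
    structure, whence the hypothesis on 1. *)
Lemma idealr_of_is_ideal I : is_ideal I -> ~ I 1 ->
  exists J : idealr R, forall x, x \in J <-> I x.
Proof.
move=> hI nI1; pose S := fun x => `[< I x >].
have Sc : idealr_closed S.
  split; [exact/asboolP/hI.1|exact/asboolP|].
  by move=> a x y /asboolP Ix /asboolP Iy; apply/asboolP; case: hI => _; apply.
pose H := isIdealr.Build R S Sc; pose J : idealr R := HB.pack S H.
by exists J => x; split=> [/asboolP|/asboolP].
Qed.

Lemma prime_of_is_ideal I : is_ideal I -> ~ I 1 ->
    (forall x y, I (x * y) -> I x \/ I y) ->
  exists J : prime_idealr R, forall x, x \in J <-> I x.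
Proof.
move=> hI nI1 Ipr; pose S := fun x => `[< I x >].
have Sc : idealr_closed S.
  split; [exact/asboolP/hI.1|exact/asboolP|].
  by move=> a x y /asboolP Ix /asboolP Iy; apply/asboolP; case: hI => _; apply.
have Sp : prime_idealr_closed S.
  move=> x y /asboolP/Ipr[] h; apply/orP; [left|right]; exact/asboolP.
pose H := isIdealr.Build R S Sc; pose H' := isPrimeIdealrClosed.Build R S Sp.
pose J : prime_idealr R := HB.pack S H H'.
by exists J => x; split=> [/asboolP|/asboolP].
Qed.

(* An ideal maximal among those containing [I] and disjoint from the
   multiplicative set [T] is prime. *)
Lemma prime_disjoint I (T : R -> Prop) : is_ideal I ->
    T 1 -> (forall x y, T x -> T y -> T (x * y)) -> (forall x, I x -> ~ T x) ->
  exists P : prime_idealr R,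
    (forall x, I x -> x \in P) /\ (forall x, T x -> x \notin P).
Proof.
move=> hI T1 TM IT.
pose good A := [/\ is_ideal A, forall x, I x -> A x & forall x, A x -> ~ T x].
have [|A [[nA|[hA IA AT]] Amax]] :=
  @classical_sets.Zorn_bigcup R (fun A => (forall x, ~ A x) \/ good A).
- move=> F FP Ftot; have [[A [FA gA]]|noA] := EM (exists A, F A /\ good A); last first.
    left=> x [A FA /= Ax]; have [/(_ x)//|gA] := FP A FA.
    by apply: noA; exists A.
  right; case: (gA) => hA IA AT; split.
  + split=> [|a x y [B FB /= Bx] [C FC /= Cy]]; first by exists A => //; case: hA.
    have [[/(_ x)//|[hB _ _]] [/(_ y)//|[hC _ _]]] := (FP B FB, FP C FC).
    have [BC|CB] := Ftot B C FB FC.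
      by exists C => //=; case: hC => _; apply=> //; apply: BC.
    by exists B => //=; case: hB => _; apply=> //; apply: CB.
  + by move=> x Ix; exists A => //; apply: IA.
  + by move=> x [B FB /= Bx]; have [/(_ x)//|[_ _ /(_ x Bx)]] := FP B FB.
- exfalso; apply: (Amax I); last by right.
  by split=> [x /nA//|/(_ 0) IA]; apply: (nA 0); apply: IA; case: hI.
(* By maximality, adding to [A] an element outside it produces an ideal that meets [T]. *)
have out x : ~ A x -> exists2 t, T t & exists a, A (t - a * x).
  move=> nAx; apply: contrapT => nt.
  apply: (Amax (add_gen A x)).
    split=> [y Ay|/(_ x) h]; first exact: add_genW.
    by apply: nAx; apply: h; apply: add_gen_gen.
  right; split; [exact: is_ideal_add_gen|by move=> y /IA; apply: add_genW|].
  by move=> y [a Ay] Ty; apply: nt; exists y => //; exists a.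
have [|x y Axy|P PA] := @prime_of_is_ideal A hA.
- by move/AT; apply.
- have [|nAx] := EM (A x); first by left.
  have [|nAy] := EM (A y); first by right.
  have [[t Tt [a At]] [u Tu [b Bu]]] := (out x nAx, out y nAy).
  exfalso; apply: (AT (t * u)); last exact: TM.
  have -> : t * u = u * (t - a * x) + (a * x) * (u - b * y) + (a * b) * (x * y)
    by ring.
  by do 2?[apply: is_idealD => //]; apply: is_idealM.
exists P; split=> x; first by move/IA/PA.
by move=> Tx; apply/negP => /PA/AT.
Qed.

Lemma maximal_prime (P : idealr R) : maximal_ideal P ->
  exists Q : prime_idealr R, Q =i P.
Proof.
move=> Pmax; have hP := is_ideal_idealr P.
have [|x y Pxy|Q QP] := prime_of_is_ideal hP.
- by rewrite idealr1.
- have [|nPx] := boolP (x \in P); first by left.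
  right; have [a Pa] : add_gen (fun z => z \in P) x 1.
    apply: contrapT => n1.
    have [J JP] := idealr_of_is_ideal (is_ideal_add_gen x hP) n1.
    have PJ : {subset P <= J} by move=> z Pz; apply/JP/add_genW.
    by move: nPx; rewrite (Pmax J PJ) //; apply/JP/add_gen_gen.
  have -> : y = y * (1 - a * x) + a * (x * y) by ring.
  by apply: (is_idealD hP); apply: (is_idealM _ hP).
by exists Q => x; apply/idP/idP => /QP.
Qed.

Lemma seq_ideal_mem (s : seq R) x : x \in s -> seq_ideal s x.
Proof. exact: gen_idealW. Qed.

(** The last term [f] is a nonzerodivisor modulo the earlier ones, so the products of powers of [f]
    with elements outside the prime [Q] avoid their ideal. A prime avoiding all these products lies
    inside [Q], contains the earlier terms and misses [f]; the chain continues downwards from it. *)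
Lemma prime_chain_regular_seq (P : idealr R) (s : seq R) :
  maximal_ideal P -> regular_seq s -> {subset s <= P} -> prime_chain P (size s).
Proof.
move=> /maximal_prime[Q QP] [_ sreg] sP.
have sQ : {subset s <= Q} by move=> x /sP; rewrite QP.
suff [C [CQ Cs]] : exists C : nat -> prime_idealr R, C 0 =i Q /\ forall i,
    (i < size s)%N -> {subset C i.+1 <= C i} /\ ~ {subset C i <= C i.+1}.
  by exists C; split=> // x; rewrite CQ QP.
elim/last_ind: s Q {P QP sP} sreg sQ => [|s f IHs] Q sreg sQ.
  by exists (fun=> Q); split.
pose T x := exists t j, t \notin Q /\ x = t * f ^+ j.
have hI := gen_ideal_is_ideal (fun x => x \in s).
have [||x Ix|Q' [sQ' TQ']] := @prime_disjoint (seq_ideal s) T hI.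
- by exists 1, 0%N; rewrite mulr1 idealr1.
- move=> x y [t [i [Qt ->]]] [u [j [Qu ->]]]; exists (t * u), (i + j)%N.
  by rewrite prime_idealrM (negPf Qt) (negPf Qu) exprD mulrACA.
- move=> [t [j [/negP Qt def_x]]]; apply: Qt.
  have It : seq_ideal s t.
    have := sreg (size s); rewrite size_rcons ltnSn nth_rcons ltnn eqxx.
    rewrite -cats1 take_size_cat // => /(_ isT) freg.
    elim: j x Ix def_x => [|j IHj] x Ix def_x; first by rewrite def_x mulr1 in Ix.
    apply: (IHj (t * f ^+ j)) => //; apply: freg.
    by move: Ix; rewrite def_x exprS mulrCA.
  apply: (gen_ideal_min (is_ideal_idealr Q) _ It).
  by move=> y ys; apply: sQ; rewrite mem_rcons inE ys orbT.
have [i si y|x xs|C [CQ' Cs]] := IHs Q'.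
- have := sreg i; rewrite size_rcons ltnS (ltnW si) => /(_ isT y).
  by rewrite nth_rcons si -cats1 take_cat si.
- by apply: sQ'; apply: seq_ideal_mem.
have Q'Q : {subset Q' <= Q}.
  move=> x Q'x; apply: contraLR Q'x => Qx; apply: TQ'.
  by exists x, 0%N; rewrite mulr1.
exists (fun i => if i is j.+1 then C j else Q); split=> // -[_|i].
  split=> [x|/(_ f)]; first by rewrite CQ'; apply: Q'Q.
  rewrite CQ' => h; have : f \notin Q'; last first.
    by rewrite h // sQ // mem_rcons mem_head.
  by apply: TQ'; exists 1, 1%N; rewrite mul1r idealr1.
by rewrite size_rcons ltnS => /Cs.
Qed.

(** Height and depth are both squeezed to [d]: a regular sequence is never longer than the chain of
    primes it yields, and chains have length at most [d]. *)
Lemma cohen_macaulay_of_regular_seq d :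
    noetherian R ->
    (forall P : idealr R, maximal_ideal P -> exists s,
      [/\ regular_seq s, {subset s <= P} & size s = d]) ->
    (forall (P : idealr R) r, prime_chain P r -> (r <= d)%N) ->
  cohen_macaulay R.
Proof.
move=> noethR regR dimR; split=> // P Pmax; have [s [sreg sP sd]] := regR P Pmax.
exists d; split; split.
- by rewrite -sd; apply: prime_chain_regular_seq.
- by move=> r; apply: dimR.
- by exists s.
- move=> s' s'reg s'P; apply: (dimR P); exact: prime_chain_regular_seq.
Qed.

(** Unlike [regular_seq], this does not ask for a proper ideal, so the unit ideal qualifies: some
    quotients in the exact sequences below may vanish. *)
Fixpoint weakly_regular (I : R -> Prop) (s : seq R) : Prop :=
  if s is f :: s' then
    (forall y, I (f * y) -> I y) /\ weakly_regular (add_gen I f) s'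
  else True.

Lemma ideal_ext I J : (forall x, I x <-> J x) -> I = J.
Proof. by move=> IJ; apply/predeqP. Qed.

Lemma weakly_regular_full I s : is_ideal I -> I 1 -> weakly_regular I s.
Proof.
elim: s I => //= f s IHs I hI I1; split.
  by move=> y _; rewrite -[y]mulr1; apply: is_idealM.
by apply: IHs; [apply: is_ideal_add_gen|apply: add_genW].
Qed.

(* The short exact sequence [0 -> R/(I:m) -> R/I -> R/(I+m) -> 0]. *)
Lemma weakly_regular_colon I m s : is_ideal I ->
  weakly_regular (colon I m) s -> weakly_regular (add_gen I m) s -> weakly_regular I s.
Proof.
elim: s I => //= f s IHs I hI [cf cs] [af As].
have regf y : I (f * y) -> I y.
  move=> Ify; have [a Ia] := af y (add_genW m hI Ify).
  have Im : I (m * a).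
    apply: (cf a); rewrite /colon.
    have -> : m * (f * a) = f * y - f * (y - a * m) by ring.
    by apply: is_idealB => //; apply: is_idealM.
  by rewrite -[y](subrK (m * a)) [in X in I (X + _)]mulrC; apply: is_idealD.
split=> //; apply: IHs; first exact: is_ideal_add_gen.
  (* Since [f] is regular modulo [I + (m)], the colon by [m] commutes with adding [f]; the exact
     sequence thus survives reduction modulo [f]. *)
  suff -> : colon (add_gen I f) m = add_gen (colon I m) f by [].
  apply: ideal_ext => z; split=> [[a Ia]|[a Ia]]; last first.
    exists (m * a); move: Ia; rewrite /colon.
    by have -> : m * (z - a * f) = m * z - m * a * f by ring.
  have [b Ib] : add_gen I m a.
    apply: af; exists z; have -> : f * a - z * m = - (m * z - a * f) by ring.
    exact: is_idealN.
  exists b; rewrite /colon.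
  have -> : m * (z - b * f) = (m * z - a * f) + f * (a - b * m) by ring.
  by apply: is_idealD => //; apply: is_idealM.
suff -> : add_gen (add_gen I f) m = add_gen (add_gen I m) f by [].
apply: ideal_ext => z; split=> -[a [b Iab]]; exists b, a; move: Iab; by rewrite addrAC.
Qed.

Lemma weakly_regularP I s : weakly_regular I s <-> forall i, (i < size s)%N -> forall y,
  foldl add_gen I (take i s) (s`_i * y) -> foldl add_gen I (take i s) y.
Proof.
elim: s I => [|f s IHs] I //=; split=> [[If /IHs Is] [|i] //|h].
  by rewrite ltnS; apply: Is.
split; first exact: (h 0%N isT).
by apply/IHs => i; apply: (h i.+1).
Qed.

Lemma seq_ideal_rcons s f : seq_ideal (rcons s f) = add_gen (seq_ideal s) f.
Proof.
have hI := gen_ideal_is_ideal (fun x => x \in s).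
have hI' := gen_ideal_is_ideal (fun x => x \in rcons s f).
apply: ideal_ext => x; split.
  apply: gen_ideal_min; first exact: is_ideal_add_gen.
  move=> y; rewrite mem_rcons inE => /orP[/eqP->|ys].
    exact: (@add_gen_gen (seq_ideal s)).
  by apply: add_genW => //; apply: seq_ideal_mem.
move=> [a sa]; rewrite -[x](subrK (a * f)); apply: (is_idealD hI').
  apply: gen_ideal_min sa => // y ys; apply: gen_idealW.
  by rewrite mem_rcons inE ys orbT.
by apply: (is_idealM _ hI'); apply: gen_idealW; rewrite mem_rcons mem_head.
Qed.

End Ideals.

(** * Passage between a ring and its quotient *)

Section Quotient.

Variables (R : comNzRingType) (M : idealr R).
Local Notation Q := {ideal_quot M}.
Local Notation proj := (\pi_Q%qT : R -> Q).

Lemma proj_surj (a : Q) : exists x, a = proj x.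
Proof. by exists (repr a); rewrite reprK. Qed.

Lemma projE (x y : R) : (proj x == proj y) = (x - y \in M).
Proof. by rewrite Quotient.idealrBE. Qed.

Lemma proj_eq0 (x : R) : (proj x == 0) = (x \in M).
Proof. by rewrite -(rmorph0 proj) projE subr0. Qed.

End Quotient.

Section QuotientTransfer.

Variables (R : comNzRingType) (M : idealr R).
Local Notation Q := {ideal_quot M}.
Local Notation proj := (\pi_Q%qT : R -> Q).

(** Lets regularity over the quotient be checked on ideals of [R] containing [M], without forming
    quotients of quotients. *)
Lemma seq_ideal_proj (s : seq R) x :
  seq_ideal (map proj s) (proj x) <-> foldl (@add_gen R) (fun y => y \in M) s x.
Proof.
elim/last_ind: s x => [|s f IHs] x.
  rewrite /= -proj_eq0; split=> [[l [lnil ->]]|/eqP->]; last first.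
    by exists [::]; split=> //; rewrite big_nil.
  case: l lnil => [|c l] lnil; first by rewrite big_nil.
  by have := lnil c (mem_head _ _).
rewrite map_rcons seq_ideal_rcons foldl_rcons.
split=> [[a]|[a Ia]].
  have [b ->] := proj_surj a; rewrite -rmorphM -rmorphB => /IHs h.
  by exists b.
by exists (proj a); rewrite -rmorphM -rmorphB; apply/IHs.
Qed.

Lemma regular_seq_proj (s : seq R) (P : idealr Q) :
  weakly_regular (fun x => x \in M) s -> (forall f, f \in s -> proj f \in P) ->
  regular_seq (map proj s).
Proof.
move=> /weakly_regularP sreg sP; split=> [h|i].
  have : 1 \in P; last by rewrite idealr1.
  apply: (gen_ideal_min (is_ideal_idealr P) _ h) => _ /mapP[f fs ->].
  exact: sP.
rewrite size_map => si a; have [y ->] := proj_surj a.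
rewrite (nth_map 0) // -map_take -rmorphM => /seq_ideal_proj h.
by apply/seq_ideal_proj; apply: sreg.
Qed.

Lemma idealr_proj (P : idealr Q) :
  exists J : idealr R, forall x, x \in J <-> proj x \in P.
Proof.
apply: idealr_of_is_ideal; last by rewrite rmorph1 idealr1.
split=> [|a x y Px Py]; first by rewrite rmorph0 rpred0.
by rewrite rmorphD rmorphM; apply: rpredD => //; apply: idealMr.
Qed.

Lemma maximal_proj (P : idealr Q) : maximal_ideal P ->
  exists J : idealr R, maximal_ideal J /\ forall x, x \in J <-> proj x \in P.
Proof.
move=> Pmax; have [J JP] := idealr_proj P; exists J; split=> // K JK.
have [||L LK] := @idealr_of_is_ideal Q (fun a => exists2 x, x \in K & a = proj x).
- split=> [|a _ _ [x Kx ->] [y Ky ->]]; first by exists 0; rewrite ?rpred0 ?rmorph0.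
  have [b ->] := proj_surj a; exists (b * x + y); last by rewrite rmorphD rmorphM.
  by rewrite rpredD // idealMr.
- move=> [x Kx /esym/eqP]; rewrite -(rmorph1 proj) projE => xM.
  have : 1 \in K; last by rewrite idealr1.
  rewrite -[1](subKr x) rpredB // JK //; apply/JP.
  by move: xM; rewrite -proj_eq0 => /eqP->; rewrite rpred0.
move=> x Kx; apply/JP; apply: (Pmax L); last by apply/LK; exists x.
move=> a Pa; have [y def_a] := proj_surj a; apply/LK; exists y => //.
by apply: JK; apply/JP; rewrite -def_a.
Qed.

Lemma noetherian_proj : noetherian R -> noetherian Q.
Proof.
move=> noethR P; have [J JP] := idealr_proj P; have [s sJ] := noethR J.
exists (map proj s) => a; split.
  have [x ->] := proj_surj a => /JP/sJ [l [ls ->]].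
  exists [seq (proj c.1, proj c.2) | c <- l]; split=> [_ /mapP[c cl ->]|].
    by apply: map_f; apply: ls.
  by rewrite rmorph_sum big_map; apply: eq_bigr => c _; rewrite rmorphM.
apply: (gen_ideal_min (is_ideal_idealr P)) => _ /mapP[x xs ->].
by apply/JP/sJ; apply: seq_ideal_mem.
Qed.

End QuotientTransfer.

(** * Zariski's lemma *)

Section Zariski.

Variable K : fieldType.

Definition adjoin_morph (R : comNzRingType) (phi : {rmorphism R -> K}) (b : K) :
  {rmorphism {poly R} -> K} := horner_morph (fun x => mulrC b (phi x)).

Lemma adjoin_morphE (R : comNzRingType) (phi : {rmorphism R -> K}) b p :
  adjoin_morph phi b p = (map_poly phi p).[b].
Proof. by []. Qed.

Lemma adjoin_morphC (R : comNzRingType) (phi : {rmorphism R -> K}) b c :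
  adjoin_morph phi b c%:P = phi c.
Proof. exact: horner_morphC. Qed.

Lemma adjoin_morphX (R : comNzRingType) (phi : {rmorphism R -> K}) b :
  adjoin_morph phi b 'X = b.
Proof. exact: horner_morphX. Qed.

(** The subring of [K] generated by the image of [phi] and [bs], encoded as the image of an iterated
    polynomial ring: an induction on [bs] then only changes the base ring. *)
Fixpoint adjoin (bs : seq K) (R : comNzRingType) (phi : {rmorphism R -> K}) :
    K -> Prop :=
  if bs is b :: bs' then adjoin bs' (adjoin_morph phi b)
  else fun x => exists r, x = phi r.

Lemma adjoin_base bs (R : comNzRingType) (phi : {rmorphism R -> K}) r :
  adjoin bs phi (phi r).
Proof.
elim: bs R phi r => [|b bs IHs] R phi r /=; first by exists r.
by rewrite -(adjoin_morphC phi b); apply: IHs.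
Qed.

Lemma adjoin_mem bs (R : comNzRingType) (phi : {rmorphism R -> K}) b :
  b \in bs -> adjoin bs phi b.
Proof.
elim: bs R phi => [|c bs IHs] R phi //=; rewrite inE => /orP[/eqP->|]; last exact: IHs.
by rewrite -[X in adjoin _ _ X](adjoin_morphX phi c); apply: adjoin_base.
Qed.

Lemma adjoinD bs (R : comNzRingType) (phi : {rmorphism R -> K}) x y :
  adjoin bs phi x -> adjoin bs phi y -> adjoin bs phi (x + y).
Proof.
elim: bs R phi => [|c bs IHs] R phi /=; last exact: IHs.
by move=> [r ->] [s ->]; exists (r + s); rewrite rmorphD.
Qed.

Lemma adjoinM bs (R : comNzRingType) (phi : {rmorphism R -> K}) x y :
  adjoin bs phi x -> adjoin bs phi y -> adjoin bs phi (x * y).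
Proof.
elim: bs R phi => [|c bs IHs] R phi /=; last exact: IHs.
by move=> [r ->] [s ->]; exists (r * s); rewrite rmorphM.
Qed.

Section Step.

Variables (R : comNzRingType) (phi : {rmorphism R -> K}).

Lemma integral_exp x j : integralOver phi x -> integralOver phi (x ^+ j).
Proof.
by move=> ix; elim: j => [|j IHj]; [apply: integral1|rewrite exprS; apply: integral_mul].
Qed.

Lemma integral_sum (T : Type) (r : seq T) (P : pred T) (F : T -> K) :
  (forall i, P i -> integralOver phi (F i)) ->
  integralOver phi (\sum_(i <- r | P i) F i).
Proof.
by move=> hF; apply: big_ind => //; [apply: integral0|move=> *; apply: integral_add].
Qed.

(** With [c] the image of the leading coefficient and [s] the degree, multiplying the equation of
    [b] by [c ^ (s - 1)] turns it into a monic equation for [c * b]. *)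
Lemma integral_lead_coef (p : {poly R}) b : phi (lead_coef p) != 0 ->
  (map_poly phi p).[b] = 0 -> integralOver phi (phi (lead_coef p) * b).
Proof.
set c := phi _ => c0 pb; have [s def_s] : exists s, size p = s.+1.
  exists (size p).-1; rewrite prednK // lt0n size_poly_eq0.
  by apply: contraNneq c0 => p0; rewrite /c p0 lead_coef0 rmorph0.
have cE : c = phi p`_s by rewrite /c lead_coefE def_s.
(* For [i < s] the division only lowers the exponent of [c]; for [i = s] it makes the coefficient
   1. *)
pose W := \poly_(i < s.+1) (phi p`_i * c ^+ (s - i) / c).
have Ws : W`_s = 1 by rewrite coef_poly ltnSn subnn mulr1 -cE divff.
have sizeW : size W = s.+1.
  by rewrite size_poly_eq // subnn mulr1 -cE divff // oner_neq0.
have Wmon : W \is monic by rewrite monicE lead_coefE sizeW Ws.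
have Wroot : root W (c * b).
  apply/eqP; rewrite horner_poly.
  transitivity (c ^+ s / c * (map_poly phi p).[b]); last by rewrite pb mulr0.
  rewrite horner_coef size_map_poly_id0 // def_s mulr_sumr.
  apply: eq_bigr => i _; rewrite coef_map exprMn.
  have -> : c ^+ s = c ^+ (s - i) * c ^+ i by rewrite -exprD subnK // -ltnS.
  by ring.
apply: integral_root_monic Wmon Wroot _; apply/integral_poly => i.
rewrite coef_poly; case: ltnP => [|_]; last exact: integral0.
rewrite ltnS leq_eqVlt => /orP[/eqP->|lt_is].
  by rewrite subnn mulr1 -cE divff //; apply: integral1.
rewrite -mulrA -(subnSK lt_is) exprS mulrAC divff // mul1r.
by apply: integral_mul; [apply: integral_id|apply/integral_exp/integral_id].
Qed.

(** The constant term of an integral equation of [b] is a multiple of [b]. As long as it vanishes in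
    [K], a factor [b] is cancelled from the equation. *)
Lemma integral_divides_base b : b != 0 -> integralOver phi b ->
  exists c g, [/\ phi c != 0, integralOver phi g & b * g = phi c].
Proof.
move=> b0 [p]; elim/poly_ind: p => [|p c IHp].
  by rewrite monicE lead_coef0 eq_sym oner_eq0.
move=> pmon proot; have [c0|c0] := eqVneq (phi c) 0.
  have p0 : p != 0.
    apply: contraTneq pmon => p0; rewrite p0 mul0r add0r monicE lead_coefC.
    apply/negP => /eqP c1; move: c0; rewrite c1 rmorph1 => /eqP.
    by rewrite oner_eq0.
  apply: IHp.
    move: pmon; rewrite !monicE lead_coefDl ?lead_coefMX //.
    by rewrite size_mulX // size_polyC; case: (c != 0) => //; rewrite ltnS lt0n size_poly_eq0.
  move: proot; rewrite !rootE rmorphD rmorphM /= map_polyX map_polyC /= c0.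
  by rewrite addr0 hornerMX mulf_eq0 (negPf b0) orbF.
exists c, (- (map_poly phi p).[b]); split=> //; last first.
  move/rootP: proot; rewrite rmorphD rmorphM /= map_polyX map_polyC /=.
  rewrite hornerD hornerMX hornerC => h.
  by apply/esym/eqP; rewrite mulrN mulrC -addr_eq0 addrC h.
apply: integral_opp; apply: integral_horner; last first.
  by exists (p * 'X + c%:P).
by apply/integral_poly => i; rewrite coef_map; apply: integral_id.
Qed.

(** Scaling [y] by [c ^ L] multiplies each lower coefficient of its equation by a power of [c ^ L].
    Once [L] bounds the degrees of these coefficients in [b], every [b ^ j] can be absorbed into the
    integral element [(c * b) ^ j]. *)
Lemma integral_adjoin_scale (c : R) b y : integralOver phi (phi c * b) ->
  integralOver (adjoin_morph phi b) y ->
  exists L, integralOver phi (phi c ^+ L * y).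
Proof.
move=> icb [P Pmon Proot]; set psi := adjoin_morph phi b in Proot.
have [r def_r] : exists r, size P = r.+1.
  by exists (size P).-1; rewrite prednK // lt0n size_poly_eq0 monic_neq0.
have Pr : P`_r = 1 by move/monicP: Pmon; rewrite lead_coefE def_r.
pose L := (\max_(j < r.+1) size (P`_j)%R)%N; exists L.
pose W := \poly_(i < r.+1) (psi P`_i * (phi c ^+ L) ^+ (r - i)).
have Ws : W`_r = 1 by rewrite coef_poly ltnSn subnn mulr1 Pr rmorph1.
have sizeW : size W = r.+1.
  by rewrite size_poly_eq // subnn mulr1 Pr rmorph1 oner_neq0.
have Wmon : W \is monic by rewrite monicE lead_coefE sizeW Ws.
have Wroot : root W (phi c ^+ L * y).
  apply/eqP; rewrite horner_poly.
  transitivity ((phi c ^+ L) ^+ r * (map_poly psi P).[y]).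
    rewrite horner_coef size_map_poly_id0; last first.
      by rewrite (monicP Pmon) rmorph1 oner_neq0.
    rewrite def_r mulr_sumr; apply: eq_bigr => i _; rewrite coef_map exprMn.
    have -> : (phi c ^+ L) ^+ r = (phi c ^+ L) ^+ (r - i) * (phi c ^+ L) ^+ i.
      by rewrite -exprD subnK // -ltnS.
    by ring.
  by rewrite (rootP Proot) mulr0.
apply: integral_root_monic Wmon Wroot _; apply/integral_poly => i.
rewrite coef_poly; case: ltnP => [|_]; last exact: integral0.
rewrite ltnS leq_eqVlt => /orP[/eqP->|lt_ir].
  by rewrite subnn mulr1 Pr rmorph1; apply: integral1.
rewrite -(subnSK lt_ir) exprS mulrA; apply: integral_mul; last first.
  by do 2!apply: integral_exp; apply: integral_id.
rewrite /psi adjoin_morphE horner_coef mulr_suml; apply: integral_sum => j _.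
have jL : (j <= L)%N.
  have ir : (i < r.+1)%N by apply: ltnW.
  apply: leq_trans (leq_bigmax (Ordinal ir)) => /=.
  by apply: leq_trans (ltnW (ltn_ord j)) (size_poly _ _).
rewrite coef_map -(subnK jL) exprD -!mulrA; apply: integral_mul.
  exact: integral_id.
rewrite mulrCA; apply: integral_mul; first exact/integral_exp/integral_id.
by rewrite mulrC -exprMn; apply: integral_exp.
Qed.

End Step.

(** The inverse of [1 + b * a(b)] cannot become integral after multiplication by a power of [a(b)]:
    clearing denominators, [1 + X * a] would divide a power of [a], to which it is coprime. *)
Lemma transcendental_not_finite (R : comNzRingType) (phi : {rmorphism R -> K}) b
    (a : {poly R}) :
    (forall q, map_poly phi q != 0 -> adjoin_morph phi b q != 0) ->
    adjoin_morph phi b a != 0 ->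
  ~ forall x, exists N,
      integralOver (adjoin_morph phi b) (adjoin_morph phi b a ^+ N * x).
Proof.
set psi := adjoin_morph phi b => btr a0 fin.
pose u := 1 + 'X * a; pose A := map_poly phi a; pose U := 1 + 'X * A.
have mapu : map_poly phi u = U by rewrite rmorphD rmorph1 rmorphM /= map_polyX.
have A0 : A != 0.
  by apply: contra_neq a0 => A0; rewrite /psi adjoin_morphE -/A A0 horner0.
have sizeU : size U = (size A).+1.
  have sXA : size ('X * A) = (size A).+1 by rewrite mulrC size_mulX.
  by rewrite /U addrC size_polyDl // sXA size_poly1 ltnS lt0n size_poly_eq0.
have U0 : U != 0 by rewrite -size_poly_eq0 sizeU.
have u0 : psi u != 0 by apply: btr; rewrite mapu.
have [N [P Pmon Proot]] := fin (psi u)^-1.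
have [r def_r] : exists r, size P = r.+1.
  by exists (size P).-1; rewrite prednK // lt0n size_poly_eq0 monic_neq0.
have Pr : P`_r = 1 by move/monicP: Pmon; rewrite lead_coefE def_r.
(* The equation of [a ^ N / u] multiplied by [u ^ r]. It vanishes at [b], hence identically over [K]
   by transcendence; all its terms but the one with [j = r] are divisible by [u]. *)
pose h := \sum_(j < r.+1) P`_j * a ^+ (N * j) * u ^+ (r - j).
have h0 : map_poly phi h = 0.
  apply/eqP/negPn/negP => /btr/negP; apply; apply/eqP; rewrite /h rmorph_sum /=.
  transitivity (psi u ^+ r * (map_poly psi P).[psi a ^+ N / psi u]).
    rewrite horner_coef size_map_poly_id0; last first.
      by rewrite (monicP Pmon) rmorph1 oner_neq0.
    rewrite def_r mulr_sumr; apply: eq_bigr => j _; rewrite coef_map !rmorphM !rmorphXn.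
    rewrite exprMn exprVn -exprM.
    have -> : psi u ^+ r = psi u ^+ (r - j) * psi u ^+ j.
      by rewrite -exprD subnK // -ltnS.
    by rewrite /=; field; rewrite expf_neq0.
  by rewrite (rootP Proot) mulr0.
have UA : U %| A ^+ (N * r).
  have : map_poly phi h = A ^+ (N * r) +
      U * \sum_(j < r) map_poly phi P`_j * A ^+ (N * j) * U ^+ (r - j).-1.
    rewrite /h big_ord_recr /= subnn mulr1 Pr mul1r rmorphD addrC rmorphXn.
    congr (_ + _); rewrite rmorph_sum mulr_sumr; apply: eq_bigr => j _.
    rewrite !rmorphM !rmorphXn /= mapu.
    by rewrite -{1}(prednK (_ : 0 < r - j)%N) ?subn_gt0 // exprS; ring.
  rewrite h0 => /esym/eqP; rewrite addr_eq0 => /eqP->.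
  by rewrite dvdpNr dvdp_mulr.
have cop : coprimep U (A ^+ (N * r)).
  apply: coprimep_expr; apply/Bezout_coprimepP; exists (1, - 'X) => /=.
  by rewrite /U mul1r mulNr -addrA subrr addr0 eqpxx.
have : size U == 1%N.
  by rewrite size_poly_eq1; apply: (coprimepP _ _ cop U (dvdpp _) UA).
by rewrite sizeU eqSS size_poly_eq0 (negPf A0).
Qed.

(** Zariski's lemma over an arbitrary base ring, with one common denominator, so that generators can
    be adjoined one at a time. The denominator found over the extension by [b] is pushed down to
    [R]: scaled by a power of the leading coefficient [c] of an equation of [b], it becomes integral
    and so divides some [c'] from the base; [c * c'] is the new denominator. *)
Lemma zariski_localized bs (R : comNzRingType) (phi : {rmorphism R -> K}) :
    (forall x, adjoin bs phi x) ->
  exists a, phi a != 0 /\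
    forall x, exists N, integralOver phi (phi a ^+ N * x).
Proof.
elim: bs R phi => [|b bs IHs] R phi /= phiK.
  exists 1; split=> [|x]; first by rewrite rmorph1 oner_neq0.
  by have [r ->] := phiK x; exists 0%N; rewrite mul1r; apply: integral_id.
have [a [a0 fin]] := IHs _ _ phiK; pose psi := adjoin_morph phi b.
have [[q [q0 qb]]|btr] := EM (exists q, map_poly phi q != 0 /\ psi q = 0); last first.
  case: (@transcendental_not_finite R phi b a) => // q q0.
  by apply/eqP => qb; apply: btr; exists q.
have [p [p0 pb]] : exists p, phi (lead_coef p) != 0 /\ (map_poly phi p).[b] = 0.
  (* As [phi] may kill the leading coefficient of [q], the polynomial is truncated to the degree of
     its image. *)
  pose p := \poly_(i < size (map_poly phi q)) q`_i.
  have mapp : map_poly phi p = map_poly phi q.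
    apply/polyP => i; rewrite !coef_map coef_poly; case: ltnP => // h.
    by rewrite -[RHS]coef_map nth_default //; apply: rmorph0.
  have lq : phi q`_(size (map_poly phi q)).-1 != 0.
    by rewrite -coef_map -lead_coefE lead_coef_eq0.
  exists p; split; last by rewrite mapp.
  rewrite lead_coef_poly //; first by rewrite lt0n size_poly_eq0.
  by apply: contraNneq lq => ->; rewrite rmorph0.
have icb := integral_lead_coef p0 pb; set c := lead_coef p in icb p0.
have [e ib] := integral_adjoin_scale icb (integral_id psi a).
have b0 : phi c ^+ e * psi a != 0 by rewrite mulf_neq0 ?expf_neq0.
have [c' [g [c'0 ig bg]]] := integral_divides_base b0 ib.
exists (c * c'); split=> [|x]; first by rewrite rmorphM mulf_neq0.
have [N ix] := fin x; have [L ix'] := integral_adjoin_scale icb ix.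
exists (N + L)%N.
have -> : phi (c * c') ^+ (N + L) * x = phi c ^+ N * phi c' ^+ L *
    (g ^+ N * (phi c ^+ (e * N) * (phi c ^+ L * (psi a ^+ N * x)))).
  rewrite rmorphM exprMn !exprD.
  have -> : g ^+ N * (phi c ^+ (e * N) * (phi c ^+ L * (psi a ^+ N * x))) =
    phi c' ^+ N * (phi c ^+ L * x) by rewrite -bg !exprMn exprM; ring.
  by ring.
apply: integral_mul; first by apply: integral_mul; apply/integral_exp/integral_id.
apply: integral_mul; first exact: integral_exp.
by apply: integral_mul => //; apply/integral_exp/integral_id.
Qed.

End Zariski.

Lemma residue_field (R : comNzRingType) (m : idealr R) : maximal_ideal m ->
  exists (K : fieldType) (phi : {rmorphism R -> K}),
    (forall y, exists x, y = phi x) /\ forall x, phi x = 0 <-> x \in m.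
Proof.
move=> mmax; pose Q := {ideal_quot m}.
have hm := is_ideal_idealr m.
have invQ (a : Q) : exists b : Q, a != 0 -> b * a = 1.
  have [x ->] := proj_surj a; rewrite proj_eq0.
  have [xm|xm] := boolP (x \in m); first by exists 0.
  suff [b] : add_gen (fun y => y \in m) x 1.
    move=> mb; exists (\pi_Q%qT b) => _; apply/esym/eqP.
    by rewrite -rmorphM -(rmorph1 (\pi_Q%qT : R -> Q)) projE.
  apply: contrapT => n1.
  have [J Jm] := idealr_of_is_ideal (is_ideal_add_gen x hm) n1.
  have mJ : {subset m <= J} by move=> z mz; apply/Jm/add_genW.
  by move: xm; rewrite (mmax J mJ) //; apply/Jm/add_gen_gen.
have [inv invP] := choice invQ.
pose inv0 a := if a == 0 then 0 else inv a.
have mulV : forall a : Q, a != 0 -> inv0 a * a = 1.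
  by move=> a a0; rewrite /inv0 (negPf a0) invP.
have invr0' : inv0 0 = 0 by rewrite /inv0 eqxx.
pose F : fieldType := HB.pack Q (GRing.ComNzRing_isField.Build Q mulV invr0').
exists F, (\pi_Q%qT : {rmorphism R -> F}); split; first exact: proj_surj.
by move=> x; rewrite -proj_eq0; split=> [->|/eqP].
Qed.

Section PolynomialRing.

Variables (k : fieldType) (n : nat).
Local Notation S := {mpoly k[n]}.

Definition upoly (i : 'I_n) (p : {poly k}) : S := (map_poly (@mpolyC n k) p).['X_i].

Lemma maximal_algebraic (m : idealr S) (i : 'I_n) : maximal_ideal m ->
  exists p : {poly k}, p \is monic /\ upoly i p \in m.
Proof.
move=> /residue_field[K [phi [phi_surj phim]]].
pose psi : {rmorphism k -> K} := phi \o @mpolyC n k.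
pose bs := [seq phi 'X_j | j <- enum 'I_n].
have psiK x : adjoin bs psi x.
  have [p ->] := phi_surj x; elim/mpolyind: p => [|c m' p _ _ IHp].
    rewrite rmorph0 -(rmorph0 psi); exact: adjoin_base.
  rewrite rmorphD; apply: adjoinD => //; rewrite -mul_mpolyC rmorphM.
  apply: adjoinM; first exact: (adjoin_base bs psi c).
  rewrite mpolyXE_id rmorph_prod; apply: big_ind.
  - by rewrite -(rmorph1 psi); apply: adjoin_base.
  - exact: adjoinM.
  move=> j _; rewrite rmorphXn; elim: (m' j) => [|e IHe].
    by rewrite expr0 -(rmorph1 psi); apply: adjoin_base.
  by rewrite exprS; apply: adjoinM => //; apply/adjoin_mem/map_f; rewrite mem_enum.
have [a [a0 fin]] := zariski_localized psiK.
have [N intX] := fin (phi 'X_i).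
(* The base is now the field [k], so the denominator is invertible there and can be removed. *)
have {intX} : integralOver psi (phi 'X_i).
  rewrite -[phi _](mulKf (expf_neq0 N a0)) -{1}rmorphXn -fmorphV.
  by apply: integral_mul => //; apply: integral_id.
case=> p pmon /rootP proot; exists p; split=> //; apply/phim.
by rewrite -horner_map -map_poly_comp.
Qed.

End PolynomialRing.

(** * A regular sequence on complete intersections *)

(** A monic polynomial is regular modulo the extension of [J]: [p * g] and [g] have the same leading
    coefficient, which therefore lies in [J]; the top term of [g] is stripped and the argument
    repeated. *)
Lemma coef_ideal_monic (R : comNzRingType) (J : R -> Prop) (p g : {poly R}) :
    is_ideal J -> p \is monic ->
  (forall j, J (p * g)`_j) -> forall j, J g`_j.
Proof.
move=> hJ pmon; move: {2}(size g) (leqnn (size g)) => s.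
elim: s g => [|s IHs] g.
  by rewrite leqn0 size_poly_eq0 => /eqP-> _ j; rewrite coef0; case: hJ.
move=> gs Jpg j; have [->|g0] := eqVneq g 0; first by rewrite coef0; case: hJ.
have Jl : J (lead_coef g).
  by have := lead_coef_Mmonic g pmon; rewrite mulrC lead_coefE => <-; apply: Jpg.
pose g' := g - lead_coef g *: 'X^((size g).-1).
have size_g' : (size g' <= s)%N.
  rewrite -ltnS; apply: leq_trans gs.
  rewrite -(prednK (_ : 0 < size g)%N) ?lt0n ?size_poly_eq0 //.
  apply/leq_sizeP => i; rewrite coefB coefZ coefXn leq_eqVlt => /orP[/eqP<-|].
    by rewrite eqxx mulr1 lead_coefE subrr.
  move=> gi; rewrite gtn_eqF // mulr0 subr0 nth_default //.
  by rewrite -(prednK (_ : 0 < size g)%N) ?lt0n ?size_poly_eq0.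
have -> : g = g' + lead_coef g *: 'X^((size g).-1) by rewrite subrK.
rewrite coefD coefZ mulrC; apply: (is_idealD hJ); last exact: (is_idealM _ hJ).
apply: IHs => // i; rewrite mulrBr coefB -scalerAr coefZ [lead_coef g * _]mulrC.
by apply: (is_idealB hJ) => //; apply: (is_idealM _ hJ).
Qed.

Section SeparatedIdeals.

Variables (k : fieldType) (n : nat).
Local Notation S := {mpoly k[n]}.
Implicit Types (i l : 'I_n) (F A X : {set 'I_n}) (p q : 'I_n -> {poly k}).

Definition separated_ideal q F : S -> Prop :=
  gen_ideal (fun x => exists2 l, l \notin F & x = upoly l (q l)).

Lemma upolyM i (u v : {poly k}) : upoly i (u * v) = upoly i u * upoly i v.
Proof. by rewrite /upoly rmorphM hornerM. Qed.

Lemma mpoly_in_exists i : exists phi : {rmorphism S -> {poly S}},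
  (forall c, phi c%:MP = c%:MP%:P) /\
  forall l, phi 'X_l = if l == i then 'X else ('X_l)%:P.
Proof.
pose phi : {rmorphism S -> {poly S}} :=
  mmap (polyC \o @mpolyC n k) (fun l => if l == i then 'X else ('X_l)%:P).
exists phi; split=> [c|l]; first by rewrite /phi /= mmapC.
by rewrite /phi /= mmapX mmap1U.
Qed.

(** Reads an element of [S] as a polynomial in the variable [i] over the other variables. The
    coefficients stay in [S], so that evaluation at ['X_i] recovers the element and ideals of [S]
    apply to the coefficients. *)
Lemma univariate_morphism i : exists phi : {rmorphism S -> {poly S}},
  (forall g, (phi g).['X_i] = g) /\ forall l (u : {poly k}),
    phi (upoly l u) = if l == i then map_poly (@mpolyC n k) u else (upoly l u)%:P.
Proof.
have [phi [phiC phiX]] := mpoly_in_exists i; exists phi; split=> [g|l u].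
  elim/mpolyind: g => [|c m g _ _ IHg]; first by rewrite rmorph0 horner0.
  rewrite rmorphD hornerD IHg -mul_mpolyC rmorphM phiC mpolyXE_id rmorph_prod.
  rewrite hornerM hornerC horner_prod; congr (_ * _ + _); apply: eq_bigr => l _.
  rewrite rmorphXn phiX horner_exp; case: eqP => [->|_]; first by rewrite hornerX.
  by rewrite hornerC.
rewrite /upoly -horner_map -map_poly_comp /=.
have -> : map_poly (phi \o mpolyC n (R:=k)) u =
    map_poly polyC (map_poly (@mpolyC n k) u).
  by rewrite -map_poly_comp; apply: eq_map_poly => c /=; rewrite phiC.
rewrite phiX; case: eqP => [_|_]; last by rewrite horner_map.
by rewrite -/(_ \Po _) comp_polyXr.
Qed.

(** The generators do not involve the variable [i], so membership in the ideal can be tested on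
    coefficients with respect to that variable. *)
Lemma separated_regular q F i (u : {poly k}) (g : S) : i \in F -> u \is monic ->
  separated_ideal q F (upoly i u * g) -> separated_ideal q F g.
Proof.
move=> iF umon Jg; have hJ : is_ideal (separated_ideal q F) by apply: gen_ideal_is_ideal.
have [phi [phiK phi_upoly]] := univariate_morphism i.
have J_in h : separated_ideal q F h -> forall j, separated_ideal q F (phi h)`_j.
  move=> [s [sJ ->]] j; rewrite rmorph_sum coef_sum big_seq.
  apply: (is_ideal_sum _ hJ) => c /sJ[l lF ->]; rewrite rmorphM phi_upoly.
  have -> : l == i = false by apply: contraNF lF => /eqP->.
  rewrite coefMC; apply: (is_idealM _ hJ); apply: gen_idealW.
  by exists l.
rewrite -(phiK g) horner_coef; apply: (is_ideal_sum _ hJ) => j _.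
rewrite mulrC; apply: (is_idealM _ hJ); apply: (coef_ideal_monic hJ) (val j).
  exact: (monic_map (@mpolyC n k) umon).
by move=> e; have := J_in _ Jg e; rewrite rmorphM phi_upoly eqxx.
Qed.

(** The elementary symmetric polynomial of degree [d] in the [y i]. *)
Definition parameter (y : 'I_n -> S) d : S :=
  \sum_(A : {set 'I_n} | #|A| == d) \prod_(i in A) y i.

Fixpoint parameters (y : 'I_n -> S) d : seq S :=
  if d is d'.+1 then parameter y d :: parameters y d' else [::].

Lemma size_parameters y d : size (parameters y d) = d.
Proof. by elim: d => //= d ->. Qed.

Lemma parameters_ideal (J : S -> Prop) y d f : is_ideal J -> (forall i, J (y i)) ->
  f \in parameters y d -> J f.
Proof.
move=> hJ Jy; elim: d => //= d IHd; rewrite inE => /orP[/eqP->|]; last exact: IHd.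
apply: is_ideal_sum => // A /eqP dA.
have /card_gt0P[i iA] : (0 < #|A|)%N by rewrite dA.
by rewrite (bigD1 i) //= mulrC; apply: is_idealM.
Qed.

(* Modulo the ideal, [parameter y #|F|] is the product of the [y i], [i \in F],
   whose quotient is filtered by the analogous rings for the sets [F :\ i]. *)
Lemma weakly_regular_separated p q F : (forall i, p i \is monic) ->
    (forall l, l \notin F -> exists r, p l = r * q l) ->
  weakly_regular (separated_ideal q F) (parameters (fun i => upoly i (p i)) #|F|).
Proof.
move=> pmon; pose y i := upoly i (p i); rewrite -/y.
move def_d : #|F| => d; elim: d F q def_d => //= d IHd F q dF pq.
pose J := separated_ideal q F; have hJ : is_ideal J by apply: gen_ideal_is_ideal.
have Jy l : l \notin F -> J (y l).
  move=> lF; have [r plE] := pq l lF; rewrite /y plE upolyM.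
  by apply: is_idealM => //; apply: gen_idealW; exists l.
have regF X g : X \subset F -> J (\prod_(i in X) y i * g) -> J g.
  move=> XF; move: g; apply: (big_ind (fun z => forall g, J (z * g) -> J g)).
  - by move=> g; rewrite mul1r.
  - by move=> u v hu hv g; rewrite -mulrA => /hu/hv.
  - by move=> i iX g; apply: separated_regular => //; apply: (subsetP XF).
(* Any other set of the same size as [F] has an element outside [F], whose [y] lies in [J]. *)
have symF : J (parameter y d.+1 - \prod_(i in F) y i).
  rewrite /parameter (bigD1 F) ?dF //= addrAC subrr add0r.
  apply: is_ideal_sum => // A /andP[/eqP dA AF].
  have /subsetPn[l lA lF] : ~~ (A \subset F).
    by apply: contra AF => AF; rewrite eqEcard AF dA dF /=.
  by rewrite (bigD1 l) //= mulrC; apply: is_idealM => //; apply: Jy.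
split=> [g Jg|].
  apply: (regF F) => //; rewrite -[X in X * g](subKr (parameter y d.+1)) mulrBl.
  apply: is_idealB => //; rewrite mulrC; exact: is_idealM.
have -> : add_gen J (parameter y d.+1) = add_gen J (\prod_(i in F) y i).
  apply: ideal_ext => x; split=> -[a Ja]; exists a.
    have -> : x - a * \prod_(i in F) y i = (x - a * parameter y d.+1) +
      a * (parameter y d.+1 - \prod_(i in F) y i) by ring.
    by apply: is_idealD => //; apply: is_idealM.
  have -> : x - a * parameter y d.+1 = (x - a * \prod_(i in F) y i) -
      a * (parameter y d.+1 - \prod_(i in F) y i) by ring.
  by apply: is_idealB => //; apply: is_idealM.
(* The product is split factor by factor: the colon by [y i] shortens the product, while adding
   [y i] gives the separated ideal of [F :\ i], with [p i] as the new polynomial. The empty product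
   gives the unit ideal. *)
suff wX s X : #|X| = s -> X \subset F ->
    weakly_regular (add_gen J (\prod_(i in X) y i)) (parameters y d).
  exact: (wX #|F|).
elim: s X => [|s IHs] X sX XF.
  have -> : X = set0 by apply/eqP; rewrite -cards_eq0 sX.
  apply: weakly_regular_full; first exact: is_ideal_add_gen.
  by rewrite big_set0; apply: add_gen_gen.
have /card_gt0P[i iX] : (0 < #|X|)%N by rewrite sX.
have iF := subsetP XF i iX.
have prodX : \prod_(j in X) y j = y i * \prod_(j in X :\ i) y j by rewrite (big_setD1 i).
apply: (@weakly_regular_colon _ _ (y i)); first exact: is_ideal_add_gen.
  suff -> : colon (add_gen J (\prod_(j in X) y j)) (y i) =
      add_gen J (\prod_(j in X :\ i) y j).
    apply: IHs; last exact: subset_trans (subD1set _ _) XF.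
    by apply/eqP; rewrite -eqSS -sX (cardsD1 i X) iX.
  apply: ideal_ext => x; split=> -[a Ja]; exists a; last first.
    rewrite prodX; have -> : y i * x - a * (y i * \prod_(j in X :\ i) y j) =
      y i * (x - a * \prod_(j in X :\ i) y j) by ring.
    exact: is_idealM.
  apply: (regF [set i]); first by rewrite sub1set.
  rewrite big_set1; move: Ja; rewrite prodX.
  by congr J; ring.
pose q' l := if l == i then p i else q l.
have hJ' : is_ideal (separated_ideal q' (F :\ i)) by apply: gen_ideal_is_ideal.
have J'y : separated_ideal q' (F :\ i) (y i).
  by apply: gen_idealW; exists i; rewrite ?setD11 // /q' eqxx.
suff -> : add_gen (add_gen J (\prod_(j in X) y j)) (y i) = separated_ideal q' (F :\ i).
  apply: IHd => [|l].
    by apply/eqP; rewrite -eqSS -dF (cardsD1 i F) iF.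
  rewrite !inE negb_and negbK /q'; case: eqP => [->|_] /=.
    by exists 1; rewrite mul1r.
  exact: pq.
apply: ideal_ext => x; split=> [[a [b Jx]]|].
  have -> : x = (x - a * y i - b * \prod_(j in X) y j) +
     (a + b * \prod_(j in X :\ i) y j) * y i by rewrite prodX; ring.
  apply: (is_idealD hJ'); last exact: (is_idealM _ hJ').
  apply: (gen_ideal_min hJ' _ Jx) => _ [l lF ->]; apply: gen_idealW; exists l.
    by rewrite !inE (negPf lF) andbF.
  by rewrite /q'; case: eqP lF => [->|//]; rewrite iF.
have hJX := is_ideal_add_gen (\prod_(j in X) y j) hJ.
apply: gen_ideal_min; first exact: is_ideal_add_gen.
move=> _ [l lF ->]; move: lF; rewrite !inE negb_and negbK /q'.
case: eqP => [-> _|_ /= lF].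
  exact: add_gen_gen.
by do 2![apply: add_genW => //]; apply: gen_idealW; exists l.
Qed.

End SeparatedIdeals.

(** * Monomial ideals and circuits *)

Section MonomialPredicates.

Variables (k : fieldType) (n : nat).
Local Notation S := {mpoly k[n]}.
Implicit Types (U : 'X_{1..n} -> Prop) (m b : 'X_{1..n}).

(** For upward closed [U], the monomial ideal whose monomials are those of [U]. Colons and sums by
    monomials become operations on predicates of exponents. *)
Definition mono_span U : S -> Prop := fun p => forall m, m \in msupp p -> U m.

Definition upward U : Prop := forall m m', U m -> (forall i, m i <= m' i)%N -> U m'.

Lemma upwardD U m b : upward U -> U m -> U (b + m)%MM.
Proof. by move=> hU /hU; apply=> i; rewrite mnmDE leq_addl. Qed.

Lemma mono_span_is_ideal U : upward U -> is_ideal (mono_span U).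
Proof.
move=> hU; split=> [m|a x y hx hy m]; first by rewrite msupp0.
move/msuppD_le; rewrite mem_cat => /orP[/msuppM_le/allpairsP[[m1 m2] /=]|]; last exact: hy.
by move=> [_ /hx Um2 ->]; apply: upwardD.
Qed.

Lemma colon_mono_span U b :
  colon (mono_span U) 'X_[b] = mono_span (fun m => U (b + m)%MM).
Proof.
apply: ideal_ext => p; rewrite /colon mulrC; split=> h m.
  move=> mp; apply: h; rewrite (perm_mem (msuppMX _ _)); exact: map_f.
by rewrite (perm_mem (msuppMX _ _)) => /mapP[m' m'p ->]; apply: h.
Qed.

Lemma add_gen_mono_span U b : upward U ->
  add_gen (mono_span U) 'X_[b] = mono_span (fun m => U m \/ (b <= m)%MM).
Proof.
move=> hU; apply: ideal_ext => p; split=> [[a ha] m|h].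
  rewrite -{1}(subrK (a * 'X_[b]) p) => /msuppD_le; rewrite mem_cat => /orP[/ha|].
    by left.
  by rewrite (perm_mem (msuppMX _ _)) => /mapP[m' _ ->]; right; apply: lem_addr.
have hI := is_ideal_add_gen 'X_[b] (mono_span_is_ideal hU).
rewrite [p]mpolyE big_seq; apply: (is_ideal_sum _ hI) => m /h Um.
rewrite -mul_mpolyC; apply: (is_idealM _ hI); case: Um => [Um|bm].
  by apply: add_genW; [apply: mono_span_is_ideal|move=> m'; rewrite msuppX inE => /eqP->].
rewrite -(submK bm) mpolyXD; apply: (is_idealM _ hI).
exact/add_gen_gen/mono_span_is_ideal.
Qed.

Lemma mono_span1 U : upward U -> mono_span U 1 <-> forall m, U m.
Proof.
move=> hU; split=> [h m|h m _]; last exact: h.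
by apply: (hU 0%MM) => [|i]; rewrite ?mnm0E //; apply: h; rewrite msupp1 inE.
Qed.

Lemma mono_idealE (A : 'X_{1..n} -> Prop) :
  @mono_ideal k n A = mono_span (fun m => exists2 a, A a & (a <= m)%MM).
Proof.
have hU : upward (fun m => exists2 a, A a & (a <= m)%MM).
  move=> m m' [a Aa am] mm'; exists a => //.
  by apply: lepm_trans am _; apply/mnm_lepP.
have hI : is_ideal (@mono_ideal k n A) by apply: gen_ideal_is_ideal.
apply: ideal_ext => p; split=> [|h].
  apply: gen_ideal_min; first exact: mono_span_is_ideal.
  by move=> _ [a Aa ->] m; rewrite msuppX inE => /eqP->; exists a => //; apply: lepm_refl.
rewrite [p]mpolyE big_seq; apply: (is_ideal_sum _ hI) => m /h [a Aa am].
rewrite -mul_mpolyC -(submK am) mpolyXD mulrA; apply: (is_idealM _ hI).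
by apply: gen_idealW; exists a.
Qed.

Lemma mono_idealX (A : 'X_{1..n} -> Prop) m :
  @mono_ideal k n A 'X_[m] <-> exists2 a, A a & (a <= m)%MM.
Proof.
rewrite mono_idealE; split=> [|h m']; first by apply; rewrite msuppX inE.
by rewrite msuppX inE => /eqP->.
Qed.

End MonomialPredicates.

(** * Circuits, augmentation and bases of initial segments *)

Section Matroids.

Variables (n : nat) (G : {set {set 'I_n}}).
Hypothesis hG : matroid_complex G.
Implicit Types (A B C D I X s t : {set 'I_n}) (i j e : 'I_n).
Local Notation circuit := (minimal_nonface G).

Lemma face_sub s t : s \in G -> t \subset s -> t \in G.
Proof. by case: hG => -[_ h _] _; apply: h. Qed.

Lemma set0_face : set0 \in G.
Proof.
by case: hG => -[/set0Pn[s sG] _ _] _; apply: face_sub sG _; apply: sub0set.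
Qed.

Lemma circuit_sub s : s \notin G -> exists2 C, circuit C & C \subset s.
Proof.
move: {2}#|s| (leqnn #|s|) => N; elim: N s => [|N IHN] s sN sG.
  by move: sG; rewrite (_ : s = set0) ?set0_face //; apply/eqP; rewrite -cards_eq0 -leqn0.
have [[i [si siG]]|h] := EM (exists i, i \in s /\ s :\ i \notin G).
  have [|C cC Cs] := IHN _ _ siG.
    by rewrite -ltnS; move: sN; rewrite (cardsD1 i s) si.
  by exists C => //; apply: subset_trans Cs (subD1set _ _).
exists s => //; split=> // i si; apply: contraT => siG.
by case: h; exists i.
Qed.

Lemma circuitN C s : circuit C -> C \subset s -> s \notin G.
Proof. by move=> [CG _] Cs; apply: contra CG => sG; apply: face_sub sG Cs. Qed.

Lemma circuit_sub_eq C D : circuit C -> circuit D -> C \subset D -> C = D.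
Proof.
move=> [CG _] [_ hD] CD; apply/eqP; rewrite eqEsubset CD /=.
apply/subsetP => i iD; apply: contraT => iC; case/negP: CG.
apply: face_sub (hD i iD) _; apply/subsetP => j jC.
by rewrite !inE (subsetP CD) // andbT; apply: contraNneq iC => <-.
Qed.

Lemma circuit_elim C D i : circuit C -> circuit D -> C <> D -> i \in C -> i \in D ->
  exists2 E, circuit E & E \subset (C :|: D) :\ i.
Proof.
move=> cC cD CD iC iD; case: hG => _ /(_ C D cC cD CD i) [|E [cE hE]].
  by rewrite inE iC iD.
by exists E.
Qed.

Lemma circuit_in_setU1 I e C : I \in G -> circuit C -> C \subset e |: I -> e \in C.
Proof.
move=> IG cC CI; apply: contraT => eC; suff /negP[] : I \notin G by [].
apply: circuitN cC _; apply/subsetP => j jC; have := subsetP CI j jC.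
rewrite !inE => /orP[/eqP jE|//].
by rewrite -jE jC in eC.
Qed.

(** Uniqueness of the fundamental circuit: eliminating [e] between two of them would leave a circuit
    inside [I]. *)
Lemma circuit_unique I e C D : I \in G -> circuit C -> circuit D ->
  C \subset e |: I -> D \subset e |: I -> C = D.
Proof.
move=> IG cC cD CI DI; apply: contrapT => CD.
have [eC eD] := (circuit_in_setU1 IG cC CI, circuit_in_setU1 IG cD DI).
have [E cE hE] := circuit_elim cC cD CD eC eD.
suff /negP[] : I \notin G by [].
apply: circuitN cE _; apply: subset_trans hE _.
by rewrite subDset subUset CI.
Qed.

(** A face [J], at first [A], is moved towards [B] without shrinking: an element [e] of [B] is
    inserted and, if this closes a circuit, an element of that circuit outside [B] is dropped. When
    [J] contains [B], any further element of [J] augments [B]. *)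
Lemma face_augment A B : A \in G -> B \in G -> (#|B| < #|A|)%N ->
  exists2 a, a \in A :\: B & a |: B \in G.
Proof.
move=> AG BG BA.
suff aug N J : (#|B :\: J| <= N)%N -> J \in G -> J \subset A :|: B ->
    (#|B| < #|J|)%N -> exists2 a, a \in A :\: B & a |: B \in G.
  by apply: (aug #|B :\: A| A) => //; apply: subsetUl.
elim: N J => [|N IHN] J BJ JG JAB ltBJ.
  have BsJ : B \subset J by rewrite -setD_eq0 -cards_eq0 -leqn0.
  have /subsetPn[a aJ aB] : ~~ (J \subset B).
    by apply: contraL ltBJ => /subset_leq_card; rewrite -leqNgt.
  exists a; first by have := subsetP JAB a aJ; rewrite !inE (negPf aB) orbF.
  by apply: face_sub JG _; rewrite subUset sub1set aJ.
have [BsJ|/subsetPn[e eB eJ]] := boolP (B \subset J).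
  by apply: (IHN J) => //; move: BsJ; rewrite -setD_eq0 => /eqP->; rewrite cards0.
have BJe X : (#|(B :\: J) :\ e| <= N)%N.
  by rewrite -ltnS; move: BJ; rewrite (cardsD1 e (B :\: J)) inE eB eJ.
have eJAB : e |: J \subset A :|: B by rewrite subUset sub1set inE eB orbT.
have [eJG|/circuit_sub[C cC CeJ]] := boolP (e |: J \in G).
  apply: (IHN (e |: J)) => //; last by rewrite cardsU1 eJ; apply: leq_trans ltBJ _.
  apply: leq_trans (BJe set0); apply/subset_leq_card/subsetP => j.
  by rewrite !inE negb_or -andbA.
have /subsetPn[f fC fB] : ~~ (C \subset B) by apply: contraL BG; apply: circuitN.
have fe : f != e by apply: contraNneq fB => ->.
have fJ : f \in J by have := subsetP CeJ f fC; rewrite !inE (negPf fe).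
apply: (IHN ((e |: J) :\ f)).
- apply: leq_trans (BJe set0); apply/subset_leq_card/subsetP => j.
  rewrite !inE negb_and negbK => /andP[/orP[/eqP->|]]; first by rewrite (negPf fB).
  by rewrite negb_or => /andP[-> ->] ->.
- apply: contraT => /circuit_sub[D cD DJ].
  have DC : D = C.
    by apply: (circuit_unique JG cD cC _ CeJ); apply: subset_trans DJ (subD1set _ _).
  by have := subsetP DJ f; rewrite DC fC !inE eqxx => /(_ isT).
- exact: subset_trans (subD1set _ _) eJAB.
- have := cardsD1 f (e |: J); rewrite cardsU1 eJ !inE fJ orbT /= => /eqP.
  by rewrite !add1n eqSS => /eqP <-.
Qed.

Definition top C : nat := \max_(i in C) i.+1.

Definition initial (t : nat) : {set 'I_n} := [set i : 'I_n | (i < t)%N].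

Lemma top_leP C (t : nat) : (top C <= t)%N = (C \subset initial t).
Proof.
apply/bigmax_leqP/subsetP => h i; first by move=> /h; rewrite inE.
by move/h; rewrite inE.
Qed.

Lemma top_gt C i : i \in C -> (i < top C)%N.
Proof. by move=> iC; rewrite /top (bigD1 i) //= leq_maxl. Qed.

Lemma top_le_n C : (top C <= n)%N.
Proof. by apply/bigmax_leqP => i _; apply: ltn_ord. Qed.

(** A basis of the initial segment together with all later elements: the full set when [t = 0], a
    basis of the matroid when [t = n]. *)
Definition partial_basis (t : nat) B : Prop :=
  [/\ forall i, (t <= i)%N -> i \in B, B :&: initial t \in G
    & forall j, (j < t)%N -> j \notin B -> j |: (B :&: initial t) \notin G].

Lemma initialS (t : nat) (ltn : (t < n)%N) B : Ordinal ltn \in B ->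
  B :&: initial t.+1 = Ordinal ltn |: (B :&: initial t).
Proof.
move=> eB; apply/setP => i; rewrite !inE ltnS leq_eqVlt.
have -> : ((i : nat) == t) = (i == Ordinal ltn) by [].
by case: eqP => [->|]; rewrite ?eB.
Qed.

Lemma partial_basis_indep (t : nat) (ltn : (t < n)%N) B : partial_basis t B ->
  Ordinal ltn |: (B :&: initial t) \in G -> partial_basis t.+1 B.
Proof.
move=> [Bt IG Imax] eIG; have eB : Ordinal ltn \in B by apply: Bt.
split=> [i /ltnW|| j]; [exact: Bt| by rewrite (initialS eB)|].
rewrite ltnS leq_eqVlt => /orP[/eqP jt|jt] jB.
  by case/negP: jB; apply: Bt; rewrite jt.
apply: contra (Imax j jt jB) => h; apply: face_sub h _.
by rewrite (initialS eB); apply: setUS; apply: subsetUr.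
Qed.

(** Removing one element of the only circuit restores independence. For maximality, adding [i]
    restores [C]; another [j] closes a circuit [D] with the old basis, and if [D] contains [i],
    eliminating [i] between [C] and [D] gives a circuit avoiding [i]. *)
Lemma partial_basis_exchange (t : nat) (ltn : (t < n)%N) B C i : partial_basis t B ->
    circuit C -> C \subset Ordinal ltn |: (B :&: initial t) -> i \in C ->
  partial_basis t.+1 (B :\ i).
Proof.
move=> [Bt IG Imax] cC CI iC; have eB : Ordinal ltn \in B by apply: Bt.
set e := Ordinal ltn in CI eB; set I := B :&: initial t in IG Imax CI.
have BiE : (B :\ i) :&: initial t.+1 = (e |: I) :\ i.
  by rewrite -(initialS eB); apply/setP => j; rewrite !inE andbA.
have CB j : j \in C -> (j \in B) && (j <= t)%N.
  move/(subsetP CI); rewrite !inE => /orP[/eqP->|/andP[-> /ltnW ->]] //.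
  by rewrite eB leqnn.
split=> [j jt||j jt].
- rewrite !inE Bt ?(ltnW jt) // andbT; apply: contraTneq jt => ->.
  by rewrite -leqNgt; case/andP: (CB i iC).
- rewrite BiE; apply: contraT => /circuit_sub[D cD DI].
  have DC : D = C.
    by apply: (circuit_unique IG cD cC _ CI); apply: subset_trans DI (subD1set _ _).
  by have := subsetP DI i; rewrite DC iC !inE eqxx => /(_ isT).
rewrite BiE !inE negb_and negbK => /orP[/eqP->|jB].
  rewrite setD1K; last exact: (subsetP CI).
  exact: circuitN cC CI.
have jt' : (j < t)%N.
  move: jt; rewrite ltnS leq_eqVlt => /orP[/eqP jE|//].
  by case/negP: jB; apply: Bt; rewrite jE.
have [D cD DI] := circuit_sub (Imax j jt' jB).
have jD := circuit_in_setU1 IG cD DI.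
have jC : j \notin C by apply: contra jB => /CB/andP[].
have [iD|iD] := boolP (i \in D); last first.
  apply: circuitN cD _; apply/subsetP => l lD; have := subsetP DI l lD.
  rewrite !inE => /orP[->//|->]; rewrite orbT andbT; apply/orP; right.
  by apply: contraNneq iD => <-.
have [|E cE ED] := circuit_elim cD cC _ iD iC; first by move=> DC; rewrite -DC jD in jC.
apply: circuitN cE _; apply: subset_trans ED _; apply/subsetP => l.
rewrite inE in_set1 => /andP[li /setUP[/(subsetP DI)|/(subsetP CI)]]; rewrite !inE li //=.
  by case/orP => ->; rewrite ?orbT.
by move=> ->; rewrite orbT.
Qed.

End Matroids.

(** * Decomposition of the deformed ideal into pure power ideals *)

Section Deformation.

Variables (k : fieldType) (n : nat) (G : {set {set 'I_n}}).
Hypothesis hG : matroid_complex G.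
Local Notation S := {mpoly k[n]}.
Local Notation circuit := (minimal_nonface G).
Implicit Types (B C D X : {set 'I_n}) (i j e : 'I_n) (a s : 'I_n -> nat) (m b : 'X_{1..n}).

(* The ideals met while decomposing the deformation [<x_C ^ top C>]: the
   variables outside [B] have been truncated at height [a], the circuits with
   [top C <= t] have been dealt with, and colons by [x_i ^ s i] were taken. *)
Definition stage (t : nat) B s a : 'X_{1..n} -> Prop := fun m =>
  (exists2 i, i \notin B & (a i <= m i)%N) \/
  (exists C, [/\ circuit C, C \subset B, (t < top C)%N
    & forall i, i \in C -> (top C <= m i + s i)%N]).

Lemma stage_upward t B s a : upward (stage t B s a).
Proof.
move=> m m' [[i iB ai]|[C [cC CB tC hC]]] mm'; [left|right].
  by exists i => //; apply: leq_trans (mm' i).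
by exists C; split=> // i /hC h; apply: leq_trans h _; rewrite leq_add2r.
Qed.

(** The next stage plus one monomial, the product over [X] of the variables to the powers
    [t.+1 - s i]: what is left of the generator of the circuit of top [t.+1] while it is being
    split. *)
Definition stage_on X (t : nat) B s a : 'X_{1..n} -> Prop := fun m =>
  stage t.+1 B s a m \/ forall i, i \in X -> (t < m i + s i)%N.

Lemma stage_on_upward X t B s a : upward (stage_on X t B s a).
Proof.
move=> m m' [h|h] mm'; first by left; apply: stage_upward mm'.
by right=> i /h; move=> h'; apply: leq_trans h' _; rewrite leq_add2r.
Qed.

Variable fs : seq S.
Local Notation good U := (weakly_regular (mono_span (k := k) U) fs).

Lemma good_ext (U V : 'X_{1..n} -> Prop) : (forall m, U m <-> V m) -> good U -> good V.
Proof. by move=> /predeqP->. Qed.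

Lemma good_colon (U V W : 'X_{1..n} -> Prop) b : upward U ->
  (forall m, U (b + m)%MM <-> V m) -> (forall m, U m \/ (b <= m)%MM <-> W m) ->
  good V -> good W -> good U.
Proof.
move=> hU /predeqP VE /predeqP WE gV gW.
apply: (@weakly_regular_colon _ _ 'X_[b]); first exact: mono_span_is_ideal.
  by rewrite colon_mono_span VE.
by rewrite add_gen_mono_span // WE.
Qed.

Lemma lem_mulU i c m : (U_(i) *+ c <= m)%MM = (c <= m i)%N.
Proof.
apply/mnm_lepP/idP => [/(_ i)|h j]; rewrite mulmnE mnm1E ?eqxx ?mul1n //.
by case: eqP => [<-|_]; rewrite ?mul1n ?mul0n.
Qed.

(** Splits along the pure power of a variable [i] in [X]. The colon raises [s i] to [t.+1], which
    deletes [i] from the monomial; adding the power truncates the variable and removes [i] from [B].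
    For empty [X] the ideal is the unit ideal. *)
Lemma good_stage_on t B C a : C \subset B ->
    (forall i s a', i \in C -> (forall j, s j <= t.+1)%N ->
      (forall j, a' j <= maxn (a j) t.+1)%N -> good (stage t.+1 (B :\ i) s a')) ->
  forall X s, X \subset C -> (forall i, s i <= t.+1)%N -> good (stage_on X t B s a).
Proof.
move=> CB goodC X; move: {2}#|X| (erefl #|X|) => N; elim: N X => [|N IHN] X XN s XC st.
  have -> : X = set0 by apply/eqP; rewrite -cards_eq0 XN.
  have hU := @stage_on_upward set0 t B s a.
  apply: weakly_regular_full; first exact: mono_span_is_ideal.
  by apply/mono_span1 => // m; right=> i; rewrite inE.
have /card_gt0P[i iX] : (0 < #|X|)%N by rewrite XN.
have [iC XiC] : i \in C /\ X :\ i \subset C.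
  by rewrite (subsetP XC) // (subset_trans (subD1set _ _) XC).
have iB := subsetP CB i iC.
pose c := (t.+1 - s i)%N; pose s' j := if j == i then t.+1 else s j.
have ms m j : ((U_(i) *+ c + m)%MM j + s j = m j + s' j)%N.
  rewrite mnmDE mulmnE mnm1E eq_sym /s'; case: eqP => [->|_] /=; last by lia.
  by have := st i; rewrite /c; lia.
pose a' j := if j == i then c else a j.
apply: (@good_colon _ (stage_on (X :\ i) t B s' a) (stage t.+1 (B :\ i) s a')
  (U_(i) *+ c)%MM).
- exact: stage_on_upward.
- move=> m; split=> -[[[l lB al]|[D [cD DB tD hD]]]|h].
  + left; left; exists l => //; move: al; rewrite mnmDE mulmnE mnm1E.
    by case: eqP lB => [<-|//]; rewrite iB.
  + by left; right; exists D; split=> // j jD; rewrite -ms hD.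
  + by right=> j; rewrite !inE => /andP[_ /h]; rewrite ms.
  + by left; left; exists l => //; rewrite mnmDE; apply: leq_trans al _; apply: leq_addl.
  + by left; right; exists D; split=> // j jD; rewrite ms hD.
  + right=> j jX; rewrite ms; have [->|ji] := eqVneq j i.
      by rewrite /s' eqxx; lia.
    by apply: h; rewrite !inE ji.
- move=> m; rewrite lem_mulU; split=> [[[[[l lB al]|[D [cD DB tD hD]]]|h]|cm]|].
  + left; exists l; first by rewrite !inE (negPf lB) andbF.
    by rewrite /a'; case: eqP lB => // ->; rewrite iB.
  (* A later circuit through [i] asks for a larger exponent at [i], so its monomial is already a
     multiple of the pure power. *)
  + have [iD|iD] := boolP (i \in D).
      left; exists i; first by rewrite setD11.
      by rewrite /a' eqxx /c; have := hD i iD; lia.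
    by right; exists D; split=> //; rewrite subsetD1 DB.
  + left; exists i; first by rewrite setD11.
    by rewrite /a' eqxx /c; have := h i iX; lia.
  + by left; exists i; rewrite ?setD11 // /a' eqxx.
  + move=> [[l]|[D [cD DB tD hD]]].
      rewrite !inE negb_and negbK /a'; case: eqP => [-> _|_ /= lB]; first by right.
      by left; left; left; exists l.
    left; left; right; exists D; split=> //; exact: subset_trans DB (subD1set _ _).
- apply: IHN => // [|j]; last by rewrite /s'; case: eqP.
  by apply/eqP; rewrite -eqSS -XN (cardsD1 i X) iX.
- apply: goodC => // j; rewrite /a'; case: eqP => _; last exact: leq_maxl.
  by apply: leq_trans (leq_maxr _ _); apply: leq_subr.
Qed.

(** Element [t] is examined. If it is independent of the basis so far, no circuit in [B] has top
    [t.+1] and the ideal is unchanged; otherwise exactly one does, and it is split. At [t = n] no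
    circuit remains, only pure powers outside a basis, with exponents still at most [n]. *)
Lemma good_stage (t : nat) B s a :
    (forall B a, B \in G -> (forall j, j \notin B -> j |: B \notin G) ->
      (forall i, a i <= n)%N ->
      good (fun m => exists2 i, i \notin B & (a i <= m i)%N)) ->
    (t <= n)%N -> partial_basis G t B ->
    (forall i, s i <= t)%N -> (forall i, a i <= n)%N ->
  good (stage t B s a).
Proof.
move=> leaf; move def_u : (n - t)%N => u.
elim: u t B s a def_u => [|u IHu] t B s a def_u tn pB st an.
  have tE : t = n by lia.
  move: pB; rewrite tE => -[_ BG Bmax].
  have BE : B :&: initial n n = B by apply/setP => i; rewrite !inE ltn_ord andbT.
  rewrite BE in BG Bmax; apply: good_ext (leaf B a BG _ an).
    move=> m; split=> [|[//|[C [_ _ nC _]]]]; first by left.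
    by have := top_le_n C; lia.
  by move=> j; apply: Bmax.
have ltn : (t < n)%N by lia.
have eB : Ordinal ltn \in B by case: pB => h _ _; apply: h.
have IG : B :&: initial n t \in G by case: pB.
have topC C : C \subset B -> (top C <= t.+1)%N =
    (C \subset Ordinal ltn |: (B :&: initial n t)).
  by move=> CB; rewrite top_leP -(initialS eB) subsetI CB.
have st' i : (s i <= t.+1)%N by apply: leqW.
have [eIG|/(circuit_sub hG)[C cC CI]] := boolP (Ordinal ltn |: (B :&: initial n t) \in G).
  apply: (@good_ext (stage t.+1 B s a)); last first.
    by apply: IHu => //; [lia|apply: partial_basis_indep eIG].
  move=> m; split=> -[h|[D [cD DB tD hD]]]; try by left.
    by right; exists D; split=> //; apply: ltnW.
  right; exists D; split=> //; rewrite ltnNge topC //; apply/negP => DI.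
  by case/negP: (circuitN hG cD DI).
have CB : C \subset B.
  by apply: subset_trans CI _; rewrite subUset sub1set eB subsetIl.
have tC : top C = t.+1.
  apply/eqP; rewrite eqn_leq topC // CI /=.
  exact: (@top_gt n C (Ordinal ltn)) (circuit_in_setU1 hG IG cC CI).
apply: (@good_ext (stage_on C t B s a)); last first.
  apply: (good_stage_on CB _ (subxx C) st') => i s' a' iC s't a'n.
  apply: IHu => //; [lia|exact: (partial_basis_exchange hG pB cC CI)|].
  by move=> j; apply: leq_trans (a'n j) _; rewrite geq_max an.
move=> m; split=> [[[h|[D [cD DB tD hD]]]|h]|[h|[D [cD DB tD hD]]]].
- by left.
- by right; exists D; split=> //; apply: ltnW.
- by right; exists C; split=> //; rewrite tC.
- by left; left.
have [tD'|tD'] := ltnP t.+1 (top D); first by left; right; exists D; split.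
right=> i iC; have DC : D = C.
  by apply: (circuit_unique hG IG cD cC _ CI); rewrite -topC.
by rewrite -tC -DC hD ?DC.
Qed.

End Deformation.

(** * Noetherianity and dimension of polynomial rings *)

Section Dickson.

(** Each term chosen is a minimum of the tail following the previous one. *)
Lemma monotone_subsequence (v : nat -> nat) :
  exists g : nat -> nat, (forall p, g p < g p.+1)%N /\
    forall p q, (p <= q)%N -> (v (g p) <= v (g q))%N.
Proof.
have tail_min N : exists j, (N <= j)%N /\ forall l, (N <= l)%N -> (v j <= v l)%N.
  suff tm c j : (N <= j)%N -> (v j <= c)%N ->
      exists j, (N <= j)%N /\ forall l, (N <= l)%N -> (v j <= v l)%N.
    exact: (tm (v N) N).
  elim: c j => [|c IHc] j Nj vj.
    by exists j; split=> // l _; apply: leq_trans vj _.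
  have [[l [Nl vl]]|h] := EM (exists l, (N <= l)%N /\ (v l < v j)%N).
    by apply: (IHc l) => //; rewrite -ltnS; apply: leq_trans vl vj.
  exists j; split=> // l Nl; rewrite leqNgt; apply/negP => vl.
  by apply: h; exists l.
have [h hP] := choice tail_min.
pose g := fix g p := if p is p'.+1 then h (g p').+1 else h 0%N.
have gS p : (g p < g p.+1)%N by case: (hP (g p).+1).
exists g; split=> // p q; elim: q => [|q IHq]; first by rewrite leqn0 => /eqP->.
rewrite leq_eqVlt => /orP[/eqP->//|/IHq h1]; apply: leq_trans h1 _.
have [lo [glo le_lo]] : exists lo, g q = h lo /\ (lo <= g q)%N.
  by case: (q) => [|q']; [exists 0%N|exists (g q').+1].
rewrite {1}glo; case: (hP lo) => _; apply.
by apply: leq_trans le_lo (ltnW (gS q)).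
Qed.

Variable n : nat.

Lemma good_sequence (u : nat -> 'X_{1..n}) :
  exists p q, (p < q)%N /\ (u p <= u q)%MM.
Proof.
suff sub r : (r <= n)%N -> exists g : nat -> nat, (forall p, g p < g p.+1)%N /\
    forall (i : 'I_n) p q, (i < r)%N -> (p <= q)%N -> (u (g p) i <= u (g q) i)%N.
  have [g [gS gmon]] := sub n (leqnn n).
  by exists (g 0%N), (g 1%N); split=> //; apply/mnm_lepP => i; apply: gmon.
elim: r => [|r IHr] rn; first by exists id; split.
have [g [gS gmon]] := IHr (ltnW rn).
have [h [hS hmon]] := monotone_subsequence (fun p => u (g p) (Ordinal rn)).
have hle p q : (p <= q)%N -> (h p <= h q)%N.
  elim: q => [|q IHq]; first by rewrite leqn0 => /eqP->.
  rewrite leq_eqVlt => /orP[/eqP->//|/IHq]; move/leq_trans; apply; exact/ltnW.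
have glt p q : (p < q)%N -> (g p < g q)%N.
  elim: q => // q IHq; rewrite ltnS leq_eqVlt => /orP[/eqP->//|/IHq].
  by move/ltn_trans; apply.
exists (g \o h); split=> [p|i p q] /=; first by apply: glt.
rewrite ltnS leq_eqVlt => /orP[/eqP ir|ir] pq; last exact: gmon ir (hle _ _ pq).
by have -> : i = Ordinal rn by [apply: val_inj]; apply: hmon.
Qed.

(** Otherwise one could choose forever elements of [A] that are multiples of no earlier choice,
    against [good_sequence]. *)
Lemma dickson (A : 'X_{1..n} -> Prop) : exists s : seq 'X_{1..n},
  (forall b, b \in s -> A b) /\ forall a, A a -> exists2 b, b \in s & (b <= a)%MM.
Proof.
apply: contrapT => noB.
have ex (s : seq _) : exists a, (forall b, b \in s -> A b) ->
    A a /\ forall b, b \in s -> ~ (b <= a)%MM.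
  apply: contrapT => h; apply: noB; exists s.
  have sA : forall b, b \in s -> A b.
    by move=> b bs; apply: contrapT => nAb; apply: h; exists b => /(_ b bs).
  split=> // a Aa; apply: contrapT => na; apply: h; exists a => _.
  by split=> // b bs ba; apply: na; exists b.
have [f fP] := choice ex.
pose us := fix us p := if p is p'.+1 then f (us p') :: us p' else [::].
have usA p b : b \in us p -> A b.
  elim: p b => //= p IHp b; rewrite inE => /orP[/eqP->|]; last exact: IHp.
  by case: (fP (us p)).
have us_mem p q : (p < q)%N -> f (us p) \in us q.
  elim: q => //= q IHq; rewrite ltnS leq_eqVlt inE => /orP[/eqP->|/IHq->].
    by rewrite eqxx.
  by rewrite orbT.
have [p [q [pq le_pq]]] := good_sequence (f \o us).
by case: (fP (us q)) => [|_ /(_ _ (us_mem p q pq))]; [apply: usA|apply].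
Qed.

(** A Groebner basis generates: Dickson's lemma gives finitely many leading monomials, and division
    lowers the leading monomial of an element of [I], by induction on the well-founded monomial
    order. *)
Lemma mpoly_noetherian (k : fieldType) : noetherian {mpoly k[n]}.
Proof.
move=> I; have hI := is_ideal_idealr I.
have [s [sA sbasis]] := dickson (fun a => exists p,
  [/\ p \in I, p != 0 & mlead p = a]).
have [f fP] : exists f : 'X_{1..n} -> {mpoly k[n]},
    forall b, b \in s -> [/\ f b \in I, f b != 0 & mlead (f b) = b].
  suff ex b : exists p : {mpoly k[n]}, b \in s -> [/\ p \in I, p != 0 & mlead p = b].
    by have [f fP] := choice ex; exists f.
  have [bs|bs] := boolP (b \in s); last by exists 0.
  by have [p hp] := sA b bs; exists p.
exists (map f s) => x; split; last first.
  by apply: (gen_ideal_min hI) => _ /mapP[b /fP[fI _ _] ->].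
have hJ : is_ideal (seq_ideal (map f s)) by apply: gen_ideal_is_ideal.
move def_m : (mlead x) => m.
elim/(well_founded_ind (@ltom_wf n)): m x def_m => m IHm x def_m xI.
have [->|x0] := eqVneq x 0; first by case: hJ.
have [|b bs bm] := sbasis m; first by exists x.
have [fI f0 fb] := fP b bs.
pose c := mleadc x / mleadc (f b).
have c0 : c != 0 by rewrite mulf_neq0 ?invr_eq0 ?mleadc_eq0.
pose q := c *: 'X_[m - b] * f b.
have q0 : c *: 'X_[m - b] != 0 :> {mpoly k[n]}.
  by rewrite -msupp_eq0 msuppMCX.
have leadq : mlead q = m by rewrite mleadM // mleadZ // mleadXm fb submK.
have coefq : q@_m = mleadc x.
  have -> : q@_m = q@_(mlead (c *: 'X_[m - b]) + mlead (f b)).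
    by rewrite mleadZ // mleadXm fb submK.
  rewrite mleadcM mleadZ // mleadXm mcoeffZ mcoeffX eqxx mulr1 /c divfK //.
  by rewrite mleadc_eq0.
have Jq : seq_ideal (map f s) q.
  by apply: (is_idealM _ hJ); apply/seq_ideal_mem/map_f.
rewrite -(subrK q x); apply: (is_idealD hJ) => //.
have qI : q \in I by apply: idealMr.
have [->|xq0] := eqVneq (x - q) 0; first by case: hJ.
apply: (IHm (mlead (x - q))) => //; last by rewrite rpredB.
rewrite lt_neqAle; apply/andP; split.
  apply: contra_neq xq0 => h; apply/eqP; rewrite -mleadc_eq0 h mcoeffB coefq.
  by rewrite def_m subrr.
by have := mleadB_le x q; rewrite leadq def_m joinxx.
Qed.

End Dickson.

(** * Chains of primes and algebraic dependence *)

Section Dimension.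

Variables (k : fieldType) (n : nat).
Local Notation S := {mpoly k[n]}.
Implicit Types (D : S -> Prop) (F : {set 'I_n}).

Lemma linear_dependence N (g : 'I_N -> S) (W : seq 'X_{1..n}) :
    (forall i m, m \in msupp (g i) -> m \in W) -> (size W < N)%N ->
  exists c : 'I_N -> k, (exists i, c i != 0) /\ \sum_i c i *: g i = 0.
Proof.
move=> gW ltWN.
pose A : 'M[k]_(N, size W) := \matrix_(i, j) (g i)@_(nth 0%MM W j).
have : kermx A != 0.
  rewrite -mxrank_eq0 mxrank_ker subn_eq0 -ltnNge.
  exact: leq_ltn_trans (rank_leq_col A) ltWN.
case/rowV0Pn => v /sub_kermxP vA v0; exists (v 0); split.
  apply: contrapT => h; case/negP: v0; apply/eqP/rowP => i; rewrite mxE.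
  by apply/eqP; apply: contrapT => vi; apply: h; exists i; apply/negP.
apply/mpolyP => m; rewrite mcoeff0 raddf_sum /=.
have [mW|mW] := boolP (m \in W); last first.
  rewrite big1 // => i _; rewrite mcoeffZ; apply/eqP; rewrite mulf_eq0.
  by apply/orP; right; rewrite mcoeff_eq0; apply: contra mW; apply: gW.
have ltmW : (index m W < size W)%N by rewrite index_mem.
have := congr1 (fun B : 'rV_(size W) => B 0 (Ordinal ltmW)) vA.
rewrite !mxE => vA0; rewrite -[RHS]vA0; apply: eq_bigr => i _.
by rewrite !mxE mcoeffZ /= nth_index.
Qed.

Lemma linear_dependence_seq (T : eqType) (L : seq T) (g : T -> S)
    (W : seq 'X_{1..n}) : uniq L ->
    (forall t m, t \in L -> m \in msupp (g t) -> m \in W) ->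
    (size W < size L)%N ->
  exists c : T -> k, (exists2 t, t \in L & c t != 0) /\ \sum_(t <- L) c t *: g t = 0.
Proof.
move=> Luniq gW ltWL; pose L' := in_tuple L.
have [|c [[i ci] sum0]] := @linear_dependence _ (fun i => g (tnth L' i)) W _ ltWL.
  by move=> i m; apply: gW; apply: mem_tnth.
pose c' t := \sum_(j | tnth L' j == t) c j.
have c'E j : c' (tnth L' j) = c j.
  rewrite /c' (big_pred1 j) // => j'; apply/eqP/eqP => [|->//].
  by apply/tuple_uniqP.
exists c'; split; first by exists (tnth L' i); [apply: mem_tnth|rewrite c'E].
rewrite big_tnth -[RHS]sum0; apply: eq_bigr => j _.
by rewrite -/L' c'E.
Qed.

Fixpoint exponents N r : seq (seq nat) :=
  if r is r'.+1 then [seq j :: l | j <- iota 0 N.+1, l <- exponents N r'] else [:: [::]].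

(* The list is read backwards: its head is the exponent of [z (r - 1)]. *)
Fixpoint power_product (z : nat -> S) r (l : seq nat) : S :=
  if r is r'.+1 then
    if l is j :: l' then z r' ^+ j * power_product z r' l' else 0
  else 1.

Lemma size_exponents N r : size (exponents N r) = (N.+1 ^ r)%N.
Proof.
by elim: r => //= r IHr; rewrite (size_allpairs _ (iota 0 N.+1)) size_iota IHr expnS.
Qed.

Lemma exponents_uniq N r : uniq (exponents N r).
Proof.
elim: r => // r IHr; apply: allpairs_uniq => //; first exact: iota_uniq.
by move=> [j l] [j' l'] _ _ /= [-> ->].
Qed.

Definition prime_pred D : Prop :=
  [/\ is_ideal D, ~ D 1 & forall x y, D (x * y) -> D x \/ D y].

(** All terms but the constant one are multiples of [z], so [P 0] lies in [D] and vanishes; then [z]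
    is cancelled modulo the prime [D'], and the exponents shift down. *)
Lemma sum_powers_prime D D' (z : S) (P : nat -> S) N : prime_pred D' ->
    is_ideal D -> (forall x, D' x -> D x) -> D z -> ~ D' z ->
    (forall j, D (P j) -> P j = 0) ->
  D' (\sum_(j < N) z ^+ j * P j) -> forall j, (j < N)%N -> P j = 0.
Proof.
move=> [hD' _ D'pr] hD D'D Dz D'z; elim: N P => // N IHN P DP.
rewrite big_ord_recl expr0 mul1r.
have -> : \sum_(i < N) z ^+ bump 0 i * P (bump 0 i) =
    z * \sum_(i < N) z ^+ i * P i.+1.
  by rewrite mulr_sumr; apply: eq_bigr => i _; rewrite /bump add1n exprS mulrA.
move=> D's; have P0 : P 0%N = 0.
  apply: DP; rewrite -[P 0%N](addrK (z * \sum_(i < N) z ^+ i * P i.+1)).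
  by apply: is_idealB => //; [apply: D'D|rewrite mulrC; apply: is_idealM].
move: D's; rewrite P0 add0r => /D'pr[//|D's] [|j] //.
by rewrite ltnS; apply: (IHN (fun j => P j.+1)) => // j'; apply: DP.
Qed.

(** Elements separating the primes are algebraically independent modulo the smallest one. A relation
    is ordered by powers of the last element; each coefficient that lies in the previous prime is
    zero by induction. *)
Lemma prime_chain_independent (D : nat -> S -> Prop) (z : nat -> S) N r :
    (forall i, prime_pred (D i)) ->
    (forall i, (i < r)%N -> [/\ forall x, D i.+1 x -> D i x, D i (z i) & ~ D i.+1 (z i)]) ->
  forall c : seq nat -> k,
    D r (\sum_(l <- exponents N r) c l *: power_product z r l) ->
    forall l, l \in exponents N r -> c l = 0.
Proof.
move=> Dpr; elim: r => [|r IHr] Dz c.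
  rewrite big_seq1 /= => Dc l; rewrite inE => /eqP->.
  apply: contrapT => /eqP c0; case: (Dpr 0%N) => h0 n1 _; apply: n1.
  have -> : 1 = (c [::])^-1%:MP * (c [::] *: 1) :> S.
    by rewrite mul_mpolyC scalerA mulVf // scale1r.
  exact: is_idealM.
have IH := IHr (fun i ir => Dz i (ltnW ir)).
have [DD Drz Dr1z] := Dz r (ltnSn r).
pose P j := \sum_(l <- exponents N r) c (j :: l) *: power_product z r l.
have sumE : \sum_(l <- exponents N r.+1) c l *: power_product z r.+1 l =
    \sum_(j < N.+1) z r ^+ j * P j.
  rewrite big_allpairs_dep -[iota 0 _]/(index_iota 0 N.+1) big_mkord.
  apply: eq_bigr => j _; rewrite mulr_sumr; apply: eq_bigr => l _ /=.
  by rewrite -scalerAr.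
rewrite sumE => Dsum.
have DP j : D r (P j) -> P j = 0.
  by move=> /IH cj; rewrite /P big_seq big1 // => l /cj ->; rewrite scale0r.
have hDr : is_ideal (D r) by case: (Dpr r).
have P0 := sum_powers_prime (Dpr r.+1) hDr DD Drz Dr1z DP Dsum.
move=> _ /allpairsP[[j l] /= [jN lr ->]].
apply: (IH (fun l => c (j :: l))) => //; rewrite -/(P j) P0; first by case: hDr.
by move: jN; rewrite -[0%N :: _]/(iota 0 N.+1) mem_iota.
Qed.

Definition supported F a (p : S) : Prop :=
  forall m, m \in msupp p -> forall i, (m i <= if i \in F then a else 0)%N.

Lemma supportedM F a b p q : supported F a p -> supported F b q ->
  supported F (a + b) (p * q).
Proof.
move=> hp hq m /msuppM_le/allpairsP[[m1 m2] /= [/hp h1 /hq h2 ->]] i.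
rewrite mnmDE; move: (h1 i) (h2 i); case: (i \in F); last by case: (m1 i).
exact: leq_add.
Qed.

Lemma supported1 F a : supported F a 1.
Proof. by move=> m; rewrite msupp1 inE => /eqP-> i; rewrite mnm0E. Qed.

Lemma supported_le F a b p : (a <= b)%N -> supported F a p -> supported F b p.
Proof.
by move=> ab hp m /hp h i; apply: leq_trans (h i) _; case: ifP.
Qed.

Lemma supported_exp F a p j : supported F a p -> supported F (j * a) (p ^+ j).
Proof.
move=> hp; elim: j => [|j IHj]; first exact: supported1.
by rewrite exprS mulSn; apply: supportedM.
Qed.

Lemma supported_power_product F a z N r l :
    (forall i, (i < r)%N -> supported F a (z i)) -> l \in exponents N r ->
  supported F (r * (N * a)) (power_product z r l).
Proof.
elim: r l => [|r IHr] l hz; first by move=> _; apply: supported1.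
move=> /allpairsP[[j l'] /= [jN lr ->]]; rewrite mulSn; apply: supportedM.
  apply: (@supported_le _ (j * a)); last by apply: supported_exp; apply: hz.
  rewrite leq_mul2r; move: jN.
  by rewrite -[0%N :: _]/(iota 0 N.+1) mem_iota ltnS /= => ->; rewrite orbT.
by apply: IHr => // i ir; apply/hz/ltnW.
Qed.

Lemma supported_monomials F a : exists W : seq 'X_{1..n},
  size W = (a.+1 ^ #|F|)%N /\
  forall m : 'X_{1..n}, (forall i, m i <= if i \in F then a else 0)%N -> m \in W.
Proof.
pose E := pffun_on (ord0 : 'I_a.+1) (mem F) predT.
exists [seq [multinom (f i : nat) | i < n] | f : {ffun 'I_n -> 'I_a.+1} <- enum E]; split.
  by rewrite size_map -cardE card_pffun_on card_ord.
move=> m hm; apply/mapP; exists [ffun i => inord (m i)]; last first.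
  apply/mnmP => i; rewrite mnmE ffunE inordK // ltnS.
  by apply: leq_trans (hm i) _; case: ifP.
rewrite mem_enum; apply/pffun_onP; split=> // ; apply/subsetP => i.
rewrite !inE ffunE; apply: contraR => /negPf iF; apply/eqP/val_inj => /=.
by move: (hm i); rewrite iF leqn0 => /eqP->; rewrite inordK.
Qed.

Lemma supported_representative F D p : is_ideal D ->
    (forall i, i \notin F -> D 'X_i) ->
  exists a p', D (p - p') /\ supported F a p'.
Proof.
move=> hD DX; elim/mpolyind: p => [|c m p _ _ [a [p' [Dp hp]]]].
  by exists 0%N, 0; split=> [|m]; rewrite ?subrr ?msupp0 //; case: hD.
have [mF|mF] := boolP [forall i, (i \in F) || (m i == 0%N)].
  exists (maxn a (mdeg m)), (c *: 'X_[m] + p'); split.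
    by rewrite opprD addrACA subrr add0r.
  move=> m' /msuppD_le; rewrite mem_cat => /orP[/msuppZ_le|/hp h i].
    rewrite msuppX inE => /eqP-> i; have := forallP mF i.
    case: (i \in F) => [_|/eqP-> //]; apply: leq_trans (leq_maxr _ _).
    by rewrite mdegE (bigD1 i) //= leq_addr.
  by apply: leq_trans (h i) _; case: ifP => // _; apply: leq_maxl.
exists a, p'; split=> //; rewrite -addrA; apply: is_idealD => //.
move: mF; rewrite negb_forall => /existsP[i]; rewrite negb_or => /andP[iF mi].
have im : (U_(i) <= m)%MM by rewrite lep1mP.
rewrite -mul_mpolyC -(submK im) mpolyXD mulrA; apply: is_idealM => //; exact: DX.
Qed.

(** The dependence is found by counting: the products of the separating elements with exponents up
    to [N] outnumber the monomials that can occur in them. *)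
Lemma prime_chain_bound (M : idealr S) d :
    (forall F : {set 'I_n}, (d < #|F|)%N ->
      exists2 m, 'X_[m] \in M & forall i, m i != 0%N -> i \in F) ->
  forall (P : idealr {ideal_quot M}) r, prime_chain P r -> (r <= d)%N.
Proof.
move=> hM P r [C [_ hC]]; rewrite leqNgt; apply/negP => ltdr.
pose proj : {rmorphism S -> {ideal_quot M}} := \pi_{ideal_quot M}%qT.
have projM x : x \in M -> proj x = 0 by rewrite -proj_eq0 => /eqP.
pose D i x := proj x \in C i.
have Dpr i : prime_pred (D i).
  split; first split.
  - by rewrite /D rmorph0 idealr0.
  - by move=> a x y Dx Dy; rewrite /D rmorphD rmorphM rpredD // idealMr.
  - by rewrite /D rmorph1 idealr1.
  by move=> x y; rewrite /D rmorphM prime_idealrM => /orP.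
(* The variables surviving modulo the smallest prime. No monomial in them lies in that prime, so
   [hM] bounds their number by [d]. *)
pose F := [set i | `[< ~ D r 'X_i >]].
have DX i : i \notin F -> D r 'X_i.
  by rewrite inE => /asboolPn/contrapT.
have [hDr Dr1 Drpr] := Dpr r.
have cardF : (#|F| <= d)%N.
  rewrite leqNgt; apply/negP => /hM[m mM mF].
  have : D r 'X_[m] by rewrite /D projM // idealr0.
  rewrite mpolyXE_id; apply: (big_ind (fun x => ~ D r x)) => //.
    by move=> x y nx ny /Drpr[].
  move=> i _; case mi : (m i) => [|e] //.
  have : i \in F by apply: mF; rewrite mi.
  rewrite inE => /asboolP nX; elim: e.+1 => // e' IHe; rewrite exprS.
  by move=> /Drpr[].
have DS i x : (i < r)%N -> D i.+1 x -> D i x by move=> /hC[h _] /h.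
have Dle i x : (i <= r)%N -> D r x -> D i x.
  move=> ir Dx; suff De e : (e <= r)%N -> D (r - e)%N x.
    by rewrite -(subKn ir); apply/De/leq_subr.
  elim: e => [_|e IHe er]; first by rewrite subn0.
  by apply: DS; [lia|rewrite subnSK //; apply/IHe/ltnW].
(* A separating element may be changed modulo the smallest prime, hence taken in the variables of
   [F] alone. *)
have ex i : exists zE : S * nat, (i < r)%N ->
    [/\ D i zE.1, ~ D i.+1 zE.1 & supported F zE.2 zE.1].
  have [ir|ir] := ltnP i r; last by exists (0, 0%N).
  have [x Dx D1x] : exists2 x, D i x & ~ D i.+1 x.
    apply: contrapT => nx; case: (hC i ir) => _; apply=> a.
    have [x ->] := proj_surj a => Dx; apply: contrapT => D1x.
    by apply: nx; exists x.
  have [a [x' [Dxx' hx']]] := supported_representative x hDr DX.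
  exists (x', a) => _; split=> //=.
    have [hDi _ _] := Dpr i; rewrite -(subKr x x'); apply: (is_idealB hDi) => //.
    by apply: Dle (ltnW ir) _.
  have [hDi _ _] := Dpr i.+1.
  move=> Dx'; apply: D1x; rewrite -(subrK x' x); apply: (is_idealD hDi) => //.
  exact: Dle.
have [zE zEP] := choice ex.
pose z i := (zE i).1; pose E := (\max_(i < r) (zE i).2)%N.
have zE' i : (i < r)%N -> supported F E (z i).
  move=> ir; case: (zEP i ir) => _ _; apply: supported_le.
  exact: (leq_bigmax (Ordinal ir)).
(* As [r * N * E + 1 <= (r * E + 1) * (N + 1)], there are at most [N * (N + 1) ^ d] monomials, fewer
   than the [(N + 1) ^ r] products since [r > d]. *)
pose N := ((r * E).+1 ^ d)%N.
have [W [sizeW WP]] := supported_monomials F (r * (N * E)).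
have [t m lN||c [[l lN cl] sum0]] :=
  @linear_dependence_seq _ _ (power_product z r) W (exponents_uniq N r).
- by move=> mt; apply: WP; apply: supported_power_product mt.
- rewrite size_exponents sizeW.
  have le1 : ((r * (N * E)).+1 ^ #|F| <= (r * (N * E)).+1 ^ d)%N by apply: leq_pexp2l.
  have le2 : ((r * (N * E)).+1 ^ d <= ((r * E).+1 * N.+1) ^ d)%N.
    case: (d) => [|d'] //; rewrite leq_exp2r //; nia.
  have le3 : (((r * E).+1 * N.+1) ^ d < N.+1 ^ d.+1)%N.
    by rewrite expnMn [X in (_ < X)%N]expnS ltn_mul2r expn_gt0 /= ltnSn.
  have le4 : (N.+1 ^ d.+1 <= N.+1 ^ r)%N by apply: leq_pexp2l.
  exact: leq_ltn_trans le1 (leq_ltn_trans le2 (leq_trans le3 le4)).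
have Dz i : (i < r)%N -> [/\ forall x, D i.+1 x -> D i x, D i (z i) & ~ D i.+1 (z i)].
  by move=> ir; case: (zEP i ir) => Dz D1z _; split=> // x; apply: DS.
case/negP: cl; apply/eqP; apply: (prime_chain_independent Dpr Dz) lN.
by rewrite sum0; case: hDr.
Qed.

End Dimension.

(** * The deformation *)

Section MatroidDeformation.

Variables (k : fieldType) (n : nat) (G : {set {set 'I_n}}).
Hypothesis hG : matroid_complex G.
Local Notation S := {mpoly k[n]}.
Local Notation circuit := (minimal_nonface G).
Implicit Types (B C D : {set 'I_n}) (a b m : 'X_{1..n}).

Definition support a : {set 'I_n} := [set i | (0 < a i)%N].

Definition top_power C : 'X_{1..n} := [multinom if i \in C then top C else 0%N | i < n].

Lemma top_powerE C i : top_power C i = if i \in C then top C else 0%N.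
Proof. exact: mnmE. Qed.

Lemma mesym1E C i : mesym1 C i = (i \in C).
Proof. exact: mnmE. Qed.

Lemma support_mesym1 C : support (mesym1 C) = C.
Proof. by apply/setP => i; rewrite inE mesym1E; case: (i \in C). Qed.

Lemma top_gt0 C i : i \in C -> (0 < top C)%N.
Proof. by move/top_gt; apply: leq_ltn_trans. Qed.

Lemma circuit_nonempty C : circuit C -> exists i, i \in C.
Proof.
move=> [CG _]; apply/set0Pn; apply: contraNneq CG => ->; exact: set0_face hG.
Qed.

Lemma lem_top_power C m :
  (top_power C <= m)%MM <-> forall i, i \in C -> (top C <= m i)%N.
Proof.
split=> [/mnm_lepP h i iC|h]; first by have := h i; rewrite top_powerE iC.
by apply/mnm_lepP => i; rewrite top_powerE; case: ifP => // /h.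
Qed.

Lemma top_power_le_sub C D m : (forall i, i \in D -> (top D <= m i)%N) ->
  (m <= top_power C)%MM -> D \subset C.
Proof.
move=> hD /mnm_lepP mC; apply/subsetP => i iD; apply: contraT => iC.
have := leq_trans (hD i iD) (mC i); rewrite top_powerE (negPf iC).
by rewrite leqNgt (top_gt0 iD).
Qed.

Lemma stanley_reisnerX a : stanley_reisner k G 'X_[a] <-> support a \notin G.
Proof.
have -> : stanley_reisner k G =
    @mono_ideal k n (fun b => exists2 s : {set 'I_n}, s \notin G & b = mesym1 s).
  rewrite /stanley_reisner /mono_ideal; congr gen_ideal; apply/predeqP => q.
  have prodX (s : {set 'I_n}) : \prod_(i in s) 'X_i = 'X_[k, mesym1 s].
    rewrite mpolyXE_id [LHS]big_mkcond; apply: eq_bigr => i _.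
    by rewrite mesym1E; case: (i \in s).
  split=> [[s sG ->]|[_ [s sG ->] ->]]; last by exists s.
  by exists (mesym1 s) => //; exists s.
rewrite mono_idealX; split=> [[_ [s sG ->] /mnm_lepP sa]|aG].
  apply: contra sG => aG; apply: (face_sub hG) aG _; apply/subsetP => i si.
  by rewrite inE; apply: leq_trans (sa i); rewrite mesym1E si.
exists (mesym1 (support a)); first by exists (support a).
by apply/mnm_lepP => i; rewrite mesym1E inE; case: (a i).
Qed.

Lemma min_gen_stanley_reisner a :
  min_gen (stanley_reisner k G) a <-> exists2 C, circuit C & a = mesym1 C.
Proof.
split=> [[/stanley_reisnerX aG amin]|[C cC ->]].
  have [C cC Ca] := circuit_sub hG aG; exists C => //; apply/esym/amin.
    by apply/stanley_reisnerX; rewrite support_mesym1; case: cC.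
  apply/mnm_lepP => i; rewrite mesym1E; case: (boolP (i \in C)) => // /(subsetP Ca).
  by rewrite inE.
split=> [|b /stanley_reisnerX bG /mnm_lepP bC].
  by apply/stanley_reisnerX; rewrite support_mesym1; case: cC.
have sbC : support b \subset C.
  apply/subsetP => i; rewrite inE => bi; have := leq_trans bi (bC i).
  by rewrite mesym1E; case: (i \in C).
have [D cD Db] := circuit_sub hG bG.
have DC := circuit_sub_eq hG cD cC (subset_trans Db sbC).
apply/mnmP => i; have := bC i; rewrite mesym1E; case: (boolP (i \in C)) => iC.
  by have := subsetP Db i; rewrite DC iC inE => /(_ isT); case: (b i) => [|[]].
by rewrite leqn0 => /eqP.
Qed.

Definition deformed_monomial m : Prop :=
  exists2 C, circuit C & forall i, i \in C -> (top C <= m i)%N.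

Lemma deformed_monomial_upward : upward deformed_monomial.
Proof.
by move=> m m' [C cC hC] mm'; exists C => // i /hC h; apply: leq_trans (mm' i).
Qed.

Lemma deformed_idealr :
  exists M : idealr S, forall p, p \in M <-> mono_span deformed_monomial p.
Proof.
apply: idealr_of_is_ideal; first exact/mono_span_is_ideal/deformed_monomial_upward.
move/(mono_span1 k deformed_monomial_upward)/(_ 0%MM) => [C cC hC].
have [i iC] := circuit_nonempty cC; have := hC i iC.
by rewrite mnm0E leqNgt (top_gt0 iC).
Qed.

Variable M : idealr S.
Hypothesis hM : forall p, p \in M <-> mono_span deformed_monomial p.

Lemma deformedX m : 'X_[m] \in M <-> deformed_monomial m.
Proof.
rewrite hM; split=> [h|h m']; first by apply: h; rewrite msuppX inE.
by rewrite msuppX inE => /eqP->.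
Qed.

Lemma min_gen_deformed a :
  min_gen (fun p => p \in M) a <-> exists2 C, circuit C & a = top_power C.
Proof.
split=> [[/deformedX[C cC /lem_top_power Ca] amin]|[C cC ->]].
  exists C => //; apply/esym/amin => //; apply/deformedX.
  by exists C => //; apply/lem_top_power/lepm_refl.
split=> [|b /deformedX[D cD hD] bC].
  by apply/deformedX; exists C => //; apply/lem_top_power/lepm_refl.
have DC := circuit_sub_eq hG cD cC (top_power_le_sub hD bC).
move: hD; rewrite DC => /lem_top_power/mnm_lepP Cb; move/mnm_lepP: bC => bC.
by apply/mnmP => i; apply/eqP; rewrite eqn_leq bC Cb.
Qed.

Lemma deformed_is_deformation :
  deformation (stanley_reisner k G) (fun p => p \in M).
Proof.
exists (fun a => top_power (support a)); split=> [a|p].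
  move=> /min_gen_stanley_reisner[C cC ->] i; rewrite support_mesym1 mesym1E.
  by rewrite top_powerE; case: ifP => // /top_gt0.
rewrite hM mono_idealE; suff -> : deformed_monomial = fun m => exists2 b,
  (exists2 a, min_gen (stanley_reisner k G) a & b = top_power (support a)) & (b <= m)%MM by [].
apply/predeqP => m; split=> [[C cC /lem_top_power Cm]|].
  exists (top_power C) => //; exists (mesym1 C); last by rewrite support_mesym1.
  by apply/min_gen_stanley_reisner; exists C.
move=> [_ [_ /min_gen_stanley_reisner[C cC ->] ->]]; rewrite support_mesym1.
by move/lem_top_power => Cm; exists C.
Qed.

Lemma deformed_is_generic : generic_ideal (fun p => p \in M).
Proof.
split.
  exists (fun a => exists2 C, circuit C & a = top_power C) => p.
  rewrite hM mono_idealE; suff -> : deformed_monomial = fun m => exists2 a,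
    (exists2 C, circuit C & a = top_power C) & (a <= m)%MM by [].
  apply/predeqP => m; split=> [[C cC /lem_top_power Cm]|[_ [C cC ->]]].
    by exists (top_power C) => //; exists C.
  by move/lem_top_power => Cm; exists C.
move=> _ _ /min_gen_deformed[C cC ->] /min_gen_deformed[D cD ->] CD [i [Ci]].
have iC : i \in C by move: Ci; rewrite top_powerE; case: (i \in C).
rewrite !top_powerE iC; case: (boolP (i \in D)) => iD tCD; last first.
  by move: (top_gt0 iC); rewrite tCD.
have top_mem B : (0 < top B)%N -> exists2 e, e \in B & top B = e.+1.
  move=> B0; apply: contrapT => h; move: (leqnn (top B)).
  rewrite -{1}(prednK B0) ltnNge => /negP; apply; apply/bigmax_leqP => e eB.
  rewrite -ltnS (prednK B0) ltn_neqAle (top_gt eB : (_ <= _)%N) andbT.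
  by apply/eqP => te; apply: h; exists e.
have [e eC te] := top_mem C (top_gt0 iC).
have [e' eD te'] := top_mem D (top_gt0 iD).
(* A shared positive exponent forces equal tops, hence a common largest element, which is the one to
   eliminate. *)
have ee' : e = e' by apply/val_inj/eqP; rewrite -eqSS -te -te' tCD.
rewrite -ee' in eD; have CD' : C <> D by move=> CD'; apply: CD; rewrite CD'.
have [E cE ECD] := circuit_elim hG cC cD CD' eC eD.
have tE : (top E < top C)%N.
  rewrite te ltnS top_leP; apply/subsetP => j /(subsetP ECD).
  rewrite !inE => /andP[je jCD]; rewrite ltn_neqAle -[(j : nat) == e]/(j == e) je /=.
  by rewrite -ltnS -te; case/orP: jCD => [/top_gt//|]; rewrite tCD => /top_gt.
have neq B : top B = top C -> top_power E <> top_power B.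
  move=> BC /mnmP EB; have [j jE] := circuit_nonempty cE.
  have := EB j; rewrite !top_powerE jE BC; case: (j \in B) => tEB.
    by move: tE; rewrite tEB ltnn.
  by have := top_gt0 jE; rewrite tEB.
exists (top_power E); split.
- by apply/min_gen_deformed; exists E.
- exact: neq.
- exact: neq.
move=> j; rewrite top_powerE; case: (boolP (j \in E)) => // jE _.
have := subsetP ECD j jE; rewrite !inE mnmE !top_powerE => /andP[_ jCD].
by apply: leq_trans tE _; rewrite leq_max; case/orP: jCD => ->; rewrite ?tCD leqnn ?orbT.
Qed.

End MatroidDeformation.

(** * The Cohen-Macaulay property of the deformation *)

Section CohenMacaulayDeformation.

Variables (k : fieldType) (n d : nat) (G : {set {set 'I_n}}).
Hypothesis hG : matroid_complex G.
Hypothesis hd : complex_dim G = d%:Z - 1.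
Local Notation S := {mpoly k[n]}.
Local Notation circuit := (minimal_nonface G).

Lemma face_card (s : {set 'I_n}) : s \in G -> (#|s| <= d)%N.
Proof.
move=> sG; have : face_dim s <= complex_dim G.
  by rewrite /complex_dim (bigD1 s) //= le_max lexx.
by rewrite hd /face_dim lerBDr subrK lez_nat.
Qed.

Lemma complex_dim_le c : (forall s, s \in G -> (#|s| <= c)%N) ->
  complex_dim G <= c%:Z - 1.
Proof.
move=> hc; apply: (big_ind (fun x => x <= c%:Z - 1)).
- by rewrite lerBDr.
- by move=> x y hx hy; rewrite ge_max hx hy.
by move=> s /hc sc; rewrite /face_dim lerB // lez_nat.
Qed.

(** A larger face would augment [B]; without one, the dimension of the complex is at most that of
    [B]. *)
Lemma basis_card B : B \in G -> (forall j, j \notin B -> j |: B \notin G) -> #|B| = d.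
Proof.
move=> BG Bmax; apply/eqP; rewrite eqn_leq face_card //= leqNgt; apply/negP => Bd.
have [[s [sG Bs]]|h] := EM (exists s, s \in G /\ (#|B| < #|s|)%N).
  have [a] := face_augment hG sG BG Bs; rewrite inE => /andP[aB _] aG.
  by have := Bmax a aB; rewrite aG.
have := @complex_dim_le #|B|; rewrite hd => /(_ _) hB.
have : d%:Z - 1 <= #|B|%:Z - 1.
  by apply: hB => s sG; rewrite leqNgt; apply/negP => Bs; apply: h; exists s.
by rewrite lerBDr subrK lez_nat leqNgt Bd.
Qed.

Variable M : idealr S.
Hypothesis hM : forall p, p \in M <-> mono_span (deformed_monomial G) p.

Lemma upolyXn i e : upoly i ('X^e : {poly k}) = 'X_[U_(i) *+ e] :> S.
Proof. by rewrite /upoly map_polyXn hornerXn mpolyXn. Qed.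

Lemma separated_mono_span B (a : 'I_n -> nat) :
  separated_ideal (fun i => 'X^(a i)) B =
  mono_span (k := k) (fun m => exists2 i, i \notin B & (a i <= m i)%N).
Proof.
transitivity (@mono_ideal k n (fun b => exists2 i, i \notin B & b = (U_(i) *+ a i)%MM)).
  rewrite /separated_ideal /mono_ideal; congr gen_ideal; apply/predeqP => q.
  split=> [[i iB ->]|[_ [i iB ->] ->]].
    by exists (U_(i) *+ a i)%MM; [exists i|rewrite upolyXn].
  by exists i; rewrite ?upolyXn.
rewrite mono_idealE; congr mono_span; apply/predeqP => m.
split=> [[_ [i iB ->]]|[i iB ai]]; first by rewrite lem_mulU; exists i.
by exists (U_(i) *+ a i)%MM; [exists i|rewrite lem_mulU].
Qed.

Lemma weakly_regular_deformed (p : 'I_n -> {poly k}) : (forall i, p i \is monic) ->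
  weakly_regular (fun x => x \in M) (parameters (fun i => upoly i (p i * 'X^n)) d).
Proof.
move=> pmon.
(* The decomposition starts with nothing truncated and every circuit, being nonempty, still to be
   treated. *)
have -> : (fun x => x \in M : Prop) = mono_span (stage G 0 setT (fun=> 0%N) (fun=> 0%N)).
  apply: ideal_ext => x; rewrite hM.
  suff -> : deformed_monomial G = stage G 0 setT (fun=> 0%N) (fun=> 0%N) by [].
  apply/predeqP => m; split=> [[C cC hC]|[[i]|[C [cC _ _ hC]]]].
  - right; exists C; split=> // [|i /hC]; last by rewrite addn0.
    by have [i /top_gt0] := circuit_nonempty hG cC.
  - by rewrite inE.
  - by exists C => // i /hC; rewrite addn0.
apply: good_stage => // [B a BG Bmax an|].
  rewrite -separated_mono_span -(basis_card BG Bmax).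
  (* Truncation heights never exceed [n], so the factor ['X^n] makes one sequence of parameters
     serve all the pure power ideals. *)
  apply: weakly_regular_separated => [i|l _]; first by rewrite monicMr ?monicXn.
  by exists (p l * 'X^(n - a l)); rewrite -mulrA -exprD subnK.
split=> [i _||j]; rewrite ?inE //.
rewrite (_ : _ :&: _ = set0) ?(set0_face hG) //.
by apply/setP => i; rewrite !inE.
Qed.

Lemma deformed_cohen_macaulay : cohen_macaulay {ideal_quot M}.
Proof.
apply: (cohen_macaulay_of_regular_seq (d := d)).
- exact/noetherian_proj/mpoly_noetherian.
- move=> P /maximal_proj[J [Jmax JP]].
  have [p hp] := choice (fun i => maximal_algebraic i Jmax).
  have pmon i : p i \is monic by case: (hp i).
  pose y i := upoly i (p i * 'X^n).
  have yJ i : y i \in J.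
    by rewrite /y upolyM mulrC idealMr //; case: (hp i).
  have fP f : f \in parameters y d -> \pi_{ideal_quot M}%qT f \in P.
    by move/(parameters_ideal (is_ideal_idealr J) yJ) => /JP.
  exists (map \pi_{ideal_quot M}%qT (parameters y d)); split.
  + exact: (regular_seq_proj (weakly_regular_deformed pmon) fP).
  + by move=> _ /mapP[f /fP h ->].
  + by rewrite size_map size_parameters.
(* A set with more than [d] elements is not a face, so it contains a circuit, whose generator
   involves only variables of [F]. *)
apply: prime_chain_bound => F dF.
have [|C cC CF] := circuit_sub hG (s := F).
  by apply: contraL dF => /face_card; rewrite -leqNgt.
exists (top_power C).
  by apply/(deformedX hM); exists C => //; apply/lem_top_power/lepm_refl.
by move=> i; rewrite top_powerE; case: ifP => // /(subsetP CF).
Qed.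

End CohenMacaulayDeformation.

Theorem theorem2p4 (k : fieldType) (n d : nat) (G : {set {set 'I_n}})
    (hG : matroid_complex G) (hd : complex_dim G = d%:Z - 1) :
  exists M : idealr {mpoly k[n]},
    [/\ deformation (stanley_reisner k G) (fun p => p \in M),
        generic_ideal (fun p => p \in M)
      & cohen_macaulay {ideal_quot M}].
Proof.
have [M hM] := deformed_idealr k hG; exists M; split.
- exact: (deformed_is_deformation hG hM).
- exact: (deformed_is_generic hG hM).
- exact: (deformed_cohen_macaulay hG hd hM).
Qed.
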